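(* Supposing $\mathbf{g}_{r,j}\sim\mathcal{CN}(\mathbf{0},\mu_{r,j}^2\mathbf{I}_M)$ and $\mathbf{g}_{d,j}\sim\mathcal{CN}(\mathbf{0},\mu_{d,j}^2\mathbf{I}_N)$, a closed-form expression of the secrecy outage probability $$p^{k,j}_{\mathrm{so}}=\Pr\Big\{D_{k,j}<\log_2\Big(1+\big|(\sqrt{\alpha_1\alpha_{r,j}}\,\mathbf{g}_{r,j}^H\mathbf{\Theta}\mathbf{H}+\sqrt{\alpha_{d,j}}\,\mathbf{g}_{d,j}^H)\mathbf{w}\big|^2/\sigma_j^2\Big)\Big\}$$ is given by $$p^{k,j}_{\mathrm{so}}=\exp\left(-\frac{2^{D_{k,j}}-1}{\kappa_{1,j}(\mathbf{\Theta}\mathbf{H}\mathbf{w})^H\mathbf{\Theta}\mathbf{H}\mathbf{w}+\kappa_{2,j}\mathbf{w}^H\mathbf{w}}\right),\quad\forall k,j,$$ where $\kappa_{1,j}=\alpha_1\alpha_{r,j}\mu_{r,j}^2/\sigma_j^2$ and $\kappa_{2,j}=\alpha_{d,j}\mu_{d,j}^2/\sigma_j^2$.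
   Context: A base station (BS) with $N$ antennas multicasts to $K$ single-antenna users, indexed by $k\in\{1,\dots,K\}$, with the help of a reconfigurable intelligent surface (RIS) with $M$ reflecting elements, in the presence of $J$ single-antenna eavesdroppers, indexed by $j\in\{1,\dots,J\}$. $\mathbf{H}\in\mathbb{C}^{M\times N}$ is the BS-RIS channel; $\mathbf{g}_{r,j}\in\mathbb{C}^{M\times 1}$ and $\mathbf{g}_{d,j}\in\mathbb{C}^{N\times 1}$ are the channels from the RIS to eavesdropper $j$ and from the BS to eavesdropper $j$, of which the BS knows only the statistics, so that the probability is over these two channels. $\mathbf{\Theta}\in\mathbb{C}^{M\times M}$ is the diagonal matrix of RIS phase-shift coefficients, with $|\mathbf{\Theta}_{m,m}|=1$ for all $m$; $\mathbf{w}\in\mathbb{C}^{N\times 1}$ is the beamforming vector; $D_{k,j}$ is the redundancy rate of user $k$ with respect to eavesdropper $j$; $\alpha_1,\alpha_{r,j},\alpha_{d,j}$ are the path-loss coefficients of the links BS-RIS, RIS-eavesdropper $j$ and BS-eavesdropper $j$; $\sigma_j^2$ is the receiver noise variance at eavesdropper $j$. $\mathcal{CN}(\mathbf{0},\mathbf{\Sigma})$ denotes the circularly symmetric complex normal distribution with mean zero and covariance $\mathbf{\Sigma}$, $\mathbf{I}_n$ is the $n\times n$ identity matrix, and $(\cdot)^H$ is the conjugate transpose.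
   Formalization: For each j the channels g_{r,j} and g_{d,j} are assumed independent (the formula fails e.g. for g_{r,j} = g_{d,j}); redundancy rates D_{k,j} and path-loss coefficients are assumed nonnegative, the noise variance positive, and the denominator of the closed form nonzero. *)

(* Defs.v *)
From mathcomp Require Export all_boot all_order all_algebra.
From mathcomp Require Export complex.
From mathcomp Require Export all_classical all_reals all_analysis.

Set Implicit Arguments.
Unset Strict Implicit.
Unset Printing Implicit Defensive.

Export Order.TTheory GRing.Theory Num.Theory.
Export numFieldNormedType.Exports.

Local Open Scope classical_set_scope.
Local Open Scope complex_scope.
Local Open Scope sesquilinear_scope.
Local Open Scope ring_scope.

Definition log2 (R : realType) (x : R) : R := ln x / ln 2.

(* The library puts the product (Borel) sigma-algebra of R^n on n.-tuple R,
   and none on column vectors. *)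
Definition tuple_of_cV (R : realType) n (x : 'cV[R]_n) : n.-tuple R :=
  [tuple x i 0 | i < n].

Definition random_vector d (T : measurableType d) (R : realType) n
    (X : T -> 'cV[R]_n) : Prop :=
  measurable_fun [set: T] (fun t => tuple_of_cV (X t)).

Definition eq_law (R : realType) n
    d1 (T1 : measurableType d1) (P1 : probability T1 R) (X1 : T1 -> 'cV[R]_n)
    d2 (T2 : measurableType d2) (P2 : probability T2 R) (X2 : T2 -> 'cV[R]_n)
    : Prop :=
  forall A : set (n.-tuple R), measurable A ->
    P1 [set t | A (tuple_of_cV (X1 t))] = P2 [set t | A (tuple_of_cV (X2 t))].

Definition independent_vectors d (T : measurableType d) (R : realType)
    (P : probability T R) m n (X : T -> 'cV[R]_m) (Y : T -> 'cV[R]_n) : Prop :=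
  forall (A : set (m.-tuple R)) (B : set (n.-tuple R)),
    measurable A -> measurable B ->
    P ([set t | A (tuple_of_cV (X t))] `&` [set t | B (tuple_of_cV (Y t))]) =
    (P [set t | A (tuple_of_cV (X t))] * P [set t | B (tuple_of_cV (Y t))])%E.

(* Taking all A i but one equal to setT gives the N(0,1) marginals; the product
   rule is then the mutual independence of the coordinates. *)
Definition standard_gaussian_vector d (T : measurableType d) (R : realType)
    (P : probability T R) n (W : T -> 'cV[R]_n) : Prop :=
  random_vector W /\
  forall A : 'I_n -> set R, (forall i, measurable (A i)) ->
    P [set t | forall i, A i (W t i 0)] =
    (\prod_(i < n) normal_prob 0 1 (A i))%E.

(* W may live on another space, as T need not carry a standard Gaussian vector
   when X is degenerate. *)
Definition gaussian_vector d (T : measurableType d) (R : realType)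
    (P : probability T R) n (X : T -> 'cV[R]_n) : Prop :=
  random_vector X /\
  exists (m : nat) (A : 'M[R]_(n, m)) (b : 'cV[R]_n)
    (d' : measure_display) (T' : measurableType d') (P' : probability T' R)
    (W : T' -> 'cV[R]_m),
    standard_gaussian_vector P' W /\ eq_law P X P' (fun t => A *m W t + b).

Definition realify (R : realType) n (z : 'cV[R[i]]_n) : 'cV[R]_(n + n) :=
  col_mx (map_mx (@complex.Re R) z) (map_mx (@complex.Im R) z).

Definition circularly_symmetric d (T : measurableType d) (R : realType)
    (P : probability T R) n (Z : T -> 'cV[R[i]]_n) : Prop :=
  forall phi : R,
    eq_law P (fun t => realify ((cos phi +i* sin phi) *: Z t))
           P (fun t => realify (Z t)).

Definition has_mean d (T : measurableType d) (R : realType)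
    (P : probability T R) (X : T -> R[i]) (c : R[i]) : Prop :=
  ('E_P[fun t => complex.Re (X t)] = (complex.Re c)%:E)%E /\
  ('E_P[fun t => complex.Im (X t)] = (complex.Im c)%:E)%E.

Definition complex_normal0 d (T : measurableType d) (R : realType)
    (P : probability T R) n (Z : T -> 'cV[R[i]]_n) (S : 'M[R[i]]_n) : Prop :=
  [/\ gaussian_vector P (fun t => realify (Z t)),
      circularly_symmetric P Z,
      forall i, has_mean P (fun t => Z t i 0) 0 &
      forall i l, has_mean P (fun t => (Z t *m (Z t)^t*) i l) (S i l)].

(* Main.v *)
Require Import Defs.
From mathcomp Require Import measurable_realfun ring lra.

(* The received scalar has real part X and imaginary part -Y, where every a X + b Y
   is a sum of two independent real linear functionals of the Gaussian vectors
   g_r and g_d.  Circular symmetry and the covariance fix the characteristic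
   function of such a functional (its mean vanishes because it has the same law as
   its opposite, and its variance is read off the covariance matrix), so that
     E cos (a X + b Y) = exp (- (a^2 + b^2) S / 4).
   Writing exp (- l x^2) as a Gaussian average of cosines and applying Fubini twice
   gives E exp (- l (X^2 + Y^2)) = 1 / (1 + l S).  At the natural numbers l = k
   these are the moments of exp (- (X^2 + Y^2)), a variable in [0, 1]; Bernstein
   polynomials show that moments determine the law of such a variable, hence
   X^2 + Y^2 is exponentially distributed with mean S. *)

Set Implicit Arguments.
Unset Strict Implicit.
Unset Printing Implicit Defensive.

Local Open Scope classical_set_scope.
Local Open Scope ring_scope.

(** * Laws, integrals and independence *)

(** A Gaussian vector is known here only through its law, as an affine image of a standard vector
    that may live on another space, and it may be degenerate. No density of the received signal is
    therefore at hand, and everything passes through integrals of test functions, which depend on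
    the law alone. The test functions stay real: a cosine with an arbitrary phase carries as much as
    the complex characteristic function, since a shift by pi / 2 turns it into a sine up to sign,
    and integrating out one of two independent summands leaves a cosine whose phase is the other
    summand. X and Y are never shown to be independent: it is enough that the exponent depends on
    a^2 + b^2 alone, because each Gaussian average then contributes a factor (1 + l S)^(-1/2). A
    last obstacle is that polynomial approximation compares two laws only at distinct thresholds;
    the continuity of the exponential tail closes this gap. *)

Lemma probability_bounded_integrable d (T : measurableType d) (R : realType)
    (P : probability T R) (f : T -> R) (M : R) :
  measurable_fun [set: T] f -> (forall x, `|f x| <= M) ->
  P.-integrable [set: T] (EFin \o f).
Proof.
move=> mf fM; apply: measurable_bounded_integrable => //.
  exact: (le_lt_trans (probability_le1 P measurableT) (ltry 1)).
exists M; split; first exact: num_real.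
by move=> x Mx y _ /=; rewrite (le_trans (fM y))// ltW.
Qed.

Lemma Rintegral_probability_cst d (T : measurableType d) (R : realType)
    (P : probability T R) (r : R) : \int[P]_x r = r.
Proof.
rewrite Rintegral_cst// [X in fine X](_ : _ = 1%E) ?mulr1//.
exact: probability_setT.
Qed.

Lemma Rintegral_sum d (T : measurableType d) (R : realType)
    (mu : {measure set T -> \bar R}) (I : Type) (s : seq I) (f : I -> T -> R) :
  (forall i, mu.-integrable [set: T] (EFin \o f i)) ->
  \int[mu]_t (\sum_(i <- s) f i t) = \sum_(i <- s) \int[mu]_t f i t.
Proof.
move=> fi; elim: s => [|i s IH].
  under eq_Rintegral do rewrite big_nil.
  by rewrite big_nil Rintegral_cst// mul0r.
under eq_Rintegral do rewrite big_cons; rewrite big_cons RintegralD ?IH//.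
rewrite /comp; under eq_fun do rewrite -sumEFin.
by apply: integrable_sum => // j _; exact: fi.
Qed.

(** Both integrals are taken against the same image measure. This nonnegative version serves for
    squares, where no bound is available; the bounded version below serves for cosines. *)
Lemma eq_law_integral d1 d2 d (T1 : measurableType d1) (T2 : measurableType d2)
    (U : measurableType d) (R : realType)
    (P1 : probability T1 R) (P2 : probability T2 R) (X1 : T1 -> U) (X2 : T2 -> U)
    (f : U -> \bar R) :
  measurable_fun [set: T1] X1 -> measurable_fun [set: T2] X2 ->
  (forall A, measurable A -> P1 (X1 @^-1` A) = P2 (X2 @^-1` A)) ->
  measurable_fun [set: U] f -> (forall u, (0 <= f u)%E) ->
  (\int[P1]_x f (X1 x) = \int[P2]_x f (X2 x))%E.
Proof.
move=> mX1 mX2 e mf f0.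
have := @ge0_integral_pushforward _ _ _ _ _ _ mX1 P1 setT f measurableT mf (fun y _ => f0 y).
have := @ge0_integral_pushforward _ _ _ _ _ _ mX2 P2 setT f measurableT mf (fun y _ => f0 y).
rewrite /= !preimage_setT => <- <-.
by apply: eq_measure_integral => A mA _; exact: e.
Qed.

Lemma eq_law_Rintegral d1 d2 d (T1 : measurableType d1) (T2 : measurableType d2)
    (U : measurableType d) (R : realType)
    (P1 : probability T1 R) (P2 : probability T2 R) (X1 : T1 -> U) (X2 : T2 -> U)
    (f : U -> R) (M : R) :
  measurable_fun [set: T1] X1 -> measurable_fun [set: T2] X2 ->
  (forall A, measurable A -> P1 (X1 @^-1` A) = P2 (X2 @^-1` A)) ->
  measurable_fun [set: U] f -> (forall u, `|f u| <= M) ->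
  \int[P1]_x f (X1 x) = \int[P2]_x f (X2 x).
Proof.
move=> mX1 mX2 e mf fM; rewrite /Rintegral; congr fine.
have mf' : measurable_fun setT (EFin \o f) by exact/measurable_EFinP.
have i1 : P1.-integrable (X1 @^-1` setT) ((EFin \o f) \o X1).
  rewrite preimage_setT.
  by apply: (@probability_bounded_integrable _ _ _ _ (f \o X1) M) => [|x];
    [exact: measurableT_comp|exact: fM].
have i2 : P2.-integrable (X2 @^-1` setT) ((EFin \o f) \o X2).
  rewrite preimage_setT.
  by apply: (@probability_bounded_integrable _ _ _ _ (f \o X2) M) => [|x];
    [exact: measurableT_comp|exact: fM].
have := integral_pushforward mX1 mf' i1 measurableT.
have := integral_pushforward mX2 mf' i2 measurableT.
rewrite /= !preimage_setT => <- <-.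
by apply: eq_measure_integral => A mA _; exact: e.
Qed.

Lemma bounded_fubini d1 d2 (T1 : measurableType d1) (T2 : measurableType d2)
    (R : realType) (P1 : probability T1 R) (P2 : probability T2 R)
    (f : T1 * T2 -> R) (M : R) :
  measurable_fun [set: T1 * T2] f -> (forall z, `|f z| <= M) ->
  \int[(P1 \x P2)%E]_z f z = \int[P1]_x \int[P2]_y f (x, y) /\
  \int[P1]_x \int[P2]_y f (x, y) = \int[P2]_y \int[P1]_x f (x, y).
Proof.
move=> mf fM.
have i : (P1 \x P2)%E.-integrable setT (EFin \o f).
  exact: (@probability_bounded_integrable _ _ _ (P1 \x P2)%E f M).
have e1 : \int[(P1 \x P2)%E]_z f z = \int[P1]_x \int[P2]_y f (x, y).
  rewrite /Rintegral -(integral12_prod_meas1 i); congr fine.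
  apply: eq_integral => x _; rewrite /fubini_F fineK//.
  apply: integrable_fin_num => //.
  apply: (@probability_bounded_integrable _ _ _ P2 (fun y => f (x, y)) M) => //.
  exact: measurableT_comp.
have e2 : \int[(P1 \x P2)%E]_z f z = \int[P2]_y \int[P1]_x f (x, y).
  rewrite /Rintegral -(integral21_prod_meas1 i); congr fine.
  apply: eq_integral => y _; rewrite /fubini_G fineK//.
  apply: integrable_fin_num => //.
  apply: (@probability_bounded_integrable _ _ _ P1 (fun x => f (x, y)) M) => //.
  exact: measurableT_comp.
by split => //; rewrite -e1.
Qed.

(** The event [E] and the constant [c] are there for an induction on coordinates: [E] constrains the
    coordinates not yet summed, and [c] is its probability. Divided by [c], the law of the pair
    restricted to [E] agrees with the product measure on rectangles, hence everywhere. *)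
Lemma independent_pair_law d (T : measurableType d) (R : realType)
    (P : probability T R) (X Y : T -> R) (m1 m2 : probability R R)
    (E : set T) (c : {nonneg R}) :
  measurable_fun [set: T] X -> measurable_fun [set: T] Y -> measurable E ->
  (forall A B, measurable A -> measurable B ->
     P (X @^-1` A `&` Y @^-1` B `&` E) = (c%:num%:E * (m1 A * m2 B))%E) ->
  forall C, measurable C ->
    P ((fun t => (X t, Y t)) @^-1` C `&` E) = (c%:num%:E * (m1 \x m2) C)%E.
Proof.
move=> mX mY mE e C mC.
have mXY : measurable_fun setT (fun t => (X t, Y t)) by exact/measurable_fun_pairP.
have mpre : measurable ((fun t => (X t, Y t)) @^-1` C).
  by rewrite -[X in measurable X]setTI; exact: mXY.
(* The rescaling below divides by [c]; when [c] is 0 the event [E] itself is null. *)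
have [c0|c0] := eqVneq c%:num 0.
  rewrite c0 mul0e; apply/eqP; rewrite eq_le measure_ge0 andbT.
  apply: (@le_trans _ _ (P (X @^-1` setT `&` Y @^-1` setT `&` E))).
    rewrite !preimage_setT !setTI; apply: le_measure; rewrite ?inE//.
    exact: measurableI.
  by rewrite e// c0 mul0e.
have ci0 : 0 <= c%:num^-1 by [].
pose nu := pushforward (mrestr P mE) (fun t => (X t, Y t)).
pose nu' : {measure set (R * R) -> \bar R} := mscale (NngNum ci0) nu.
have nuE A B : measurable A -> measurable B -> nu' mXY (A `*` B) = (m1 A * m2 B)%E.
  move=> mA mB; rewrite /nu'/= /mscale/= /nu /pushforward/= /mrestr.
  rewrite (_ : _ @^-1` _ `&` E = X @^-1` A `&` Y @^-1` B `&` E)// e//.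
  by rewrite muleA -EFinM mulVf// mul1e.
rewrite (product_measure_unique nuE)// /nu'/= /mscale/= muleA -EFinM mulfV//.
by rewrite mul1e.
Qed.

(** * The characteristic function of the standard normal law *)

Section normal_integrals.
Context {R : realType}.
Notation mu := (@lebesgue_measure R).
Notation p := (@normal_pdf R 0 1).

(** The function [q] agrees almost everywhere with the Radon-Nikodym derivative of [m], since both
    integrate to [m] over every measurable set. *)
Lemma Rintegral_density (m : probability (measurableTypeR R) R) (q f : R -> R) :
  mu.-integrable [set: R] (EFin \o q) ->
  (forall A, measurable A -> m A = (\int[mu]_(x in A) (q x)%:E)%E) ->
  m.-integrable [set: R] (EFin \o f) ->
  \int[m]_x f x = \int[mu]_x (f x * q x).
Proof.
move=> qi mE fi; rewrite /Rintegral; congr fine.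
have mq : measurable_fun setT (EFin \o q) := measurable_int _ qi.
have mdom : m `<< mu.
  apply/null_content_dominatesP => A mA muA0; rewrite mE//.
  by apply: null_set_integral => //; exact: measurable_funTS.
rewrite -(Radon_Nikodym_change_of_variables mdom)//.
have mf : measurable_fun setT (EFin \o f) := measurable_int _ fi.
transitivity (\int[mu]_x ((f x)%:E * (q x)%:E))%E => //.
apply: ae_eq_integral => //=.
- apply: emeasurable_funM => //; apply: (measurable_int mu).
- exact: emeasurable_funM.
- apply: ae_eqe_mul2l => /=.
  rewrite Radon_NikodymE//=; case: cid => /= h [h1 h2 h3].
  apply: integral_ae_eq => //=.
  by move=> E E01 mE'; rewrite -h3// -mE.
Qed.

Lemma integral_normal_prob (f : R -> R) :
  (normal_prob (0 : R) 1).-integrable [set: R] (EFin \o f) ->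
  \int[normal_prob 0 1]_x f x = \int[mu]_x (f x * p x).
Proof. by apply: Rintegral_density => //; exact: integrable_normal_pdf. Qed.

Lemma normal_pdf01E (x : R) :
  p x = normal_peak 1 * expR (- (x ^+ 2 / 2)).
Proof.
rewrite normal_pdfE ?oner_eq0// /normal_fun subr0 expr1n; congr (_ * expR _).
by rewrite mulNr.
Qed.

(** Completing the exponent: the integrand times the standard density is [s] times the centred
    normal density of standard deviation [s] = (1 + a)^(-1/2). *)
Lemma normal_pdf_gaussian (a : R) : 0 <= a ->
  \int[normal_prob 0 1]_x expR (- (a * x ^+ 2 / 2)) = (Num.sqrt (1 + a))^-1.
Proof.
move=> a0.
have a1 : 0 < 1 + a by rewrite ltr_pwDl.
set s := (Num.sqrt (1 + a))^-1.
have s0 : 0 < s by rewrite invr_gt0 sqrtr_gt0.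
have sE : s ^- 2 = 1 + a by rewrite /s exprVn invrK sqr_sqrtr// ltW.
rewrite integral_normal_prob; last first.
  apply: (@probability_bounded_integrable _ _ _ _ _ 1) => [|x].
    apply: measurableT_comp => //; apply: measurableT_comp => //.
    by apply: measurable_funM => //; exact: measurable_funM.
  rewrite ger0_norm ?expR_ge0// -expR0 ler_expR oppr_le0.
  by rewrite mulr_ge0// mulr_ge0// sqr_ge0.
have pk1 : normal_peak (1:R) != 0 by rewrite gt_eqF// normal_peak_gt0// oner_eq0.
have e : normal_peak (1:R) / normal_peak s = s.
  rewrite /normal_peak invrK mulrC expr1n mul1r -mulrnAr sqrtrM ?sqr_ge0//.
  by rewrite sqrtr_sqr gtr0_norm// mulfK// gt_eqF// sqrtr_gt0 mulrn_wgt0// pi_gt0.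
transitivity (\int[mu]_x (s * normal_pdf 0 s x)).
  apply: eq_Rintegral => x _.
  rewrite normal_pdf01E normal_pdfE ?gt_eqF//.
  rewrite [RHS]mulrA -[X in _ = X * _ * _]e divfK; last first.
    by rewrite gt_eqF// normal_peak_gt0// gt_eqF.
  rewrite mulrCA -expRD /normal_fun subr0; congr (_ * expR _).
  rewrite -[s ^+ 2]invrK sE.
  by field; rewrite gt_eqF.
rewrite RintegralZl//; last exact: integrable_normal_pdf.
by rewrite /Rintegral integral_normal_pdf mulr1.
Qed.

(** An integrable majorant for the first moment. From (|x|/2 - 1)^2 >= 0 follows |x| <= 1 + x^2/4 <=
    exp (x^2/4), which uses up half of the exponent and leaves the density of variance 2. *)
Lemma absM_normal_pdf_le (x : R) :
  `|x| * p x <= normal_peak 1 / normal_peak (Num.sqrt 2) * normal_pdf 0 (Num.sqrt 2) x.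
Proof.
have s2 : Num.sqrt (2:R) != 0 by rewrite gt_eqF// sqrtr_gt0.
rewrite normal_pdf01E normal_pdfE// [leRHS]mulrA divfK; last first.
  by rewrite gt_eqF// normal_peak_gt0.
rewrite mulrCA ler_wpM2l ?normal_peak_ge0// /normal_fun subr0 sqr_sqrtr//.
have -> : - (x ^+ 2 / 2) = - x ^+ 2 / (2 *+ 2) + - (x ^+ 2 / 4) by field.
rewrite expRD mulrCA ler_piMr ?expR_ge0//.
rewrite expRN ler_pdivrMr ?expR_gt0// mul1r.
apply: le_trans (expR_ge1Dx _).
rewrite -[x ^+ 2]real_normK ?num_real//.
have := sqr_ge0 (`|x| / 2 - 1).
rewrite -subr_ge0 => h; rewrite -subr_ge0; apply: le_trans h _.
by rewrite le_eqVlt; apply/orP; left; apply/eqP; field.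
Qed.

(** A crude decay rate, sufficient to make the boundary terms at n and -n vanish in the integration
    by parts. *)
Lemma normal_pdf_le_harmonic (n : nat) (x : R) :
  `|x| = n%:R -> p x <= normal_peak 1 * 2 * harmonic n.
Proof.
move=> xn; rewrite normal_pdf01E -mulrA ler_wpM2l ?normal_peak_ge0//.
rewrite -[x ^+ 2]real_normK ?num_real// xn expRN /harmonic/=.
rewrite -[leLHS]mul1r ler_pdivrMr ?expR_gt0// mulrAC ler_pdivlMr ?ltr0n// mul1r.
apply: (@le_trans _ _ (2 * (1 + n%:R ^+ 2 / 2))); last first.
  by rewrite ler_wpM2l// expR_ge1Dx.
rewrite -natr1 -subr_ge0.
have -> : 2 * (1 + n%:R ^+ 2 / 2) - (n%:R + 1) =
  ((n%:R - 1) ^+ 2 + n%:R ^+ 2 + 1) / 2 :> R by field.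
by rewrite mulr_ge0// !addr_ge0// sqr_ge0.
Qed.

End normal_integrals.

Section normal_characteristic.
Context {R : realType}.
Notation mu := (@lebesgue_measure R).
Notation p := (@normal_pdf R 0 1).

#[local] Instance is_derive_normal_pdf (x : R) : is_derive x 1 (p : R -> R) (- x * p x).
Proof.
rewrite (_ : (p : R -> R) = fun x => normal_peak 1 * expR (- (x ^+ 2 / 2))); last first.
  by apply/funext => y; rewrite normal_pdf01E.
apply: is_derive_eq.
rewrite /GRing.scale/= !mulr0 ?add0r ?addr0 ?mulr1.
by field.
Qed.

Lemma integrable_absM_normal_pdf :
  mu.-integrable [set: R] (EFin \o (fun x => `|x| * p x)).
Proof.
set s := Num.sqrt (2:R); set c := normal_peak (1:R) / normal_peak s.
have i : mu.-integrable [set: R] (fun x => (c%:E * (normal_pdf 0 s x)%:E)%E).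
  by apply: integrableZl => //; exact: integrable_normal_pdf.
apply: le_integrable i => //.
  apply/measurable_EFinP; apply: measurable_funM.
    exact: normr_measurable.
  exact: measurable_normal_pdf.
move=> x _ /=; rewrite lee_fin ger0_norm; last by rewrite mulr_ge0 ?normal_pdf_ge0.
exact: le_trans (absM_normal_pdf_le x) (ler_norm _).
Qed.

Lemma integrable_bounded_normal_pdf (f : R -> R) : measurable_fun setT f ->
  (forall x, `|f x| <= 1) -> mu.-integrable [set: R] (EFin \o (fun x => f x * p x)).
Proof.
move=> mf f1.
apply: le_integrable (@integrable_normal_pdf R 0 1) => //.
  apply/measurable_EFinP; apply: measurable_funM => //.
  exact: measurable_normal_pdf.
move=> x _ /=; rewrite lee_fin normrM ler_piMl ?f1//.
Qed.

Lemma integrable_id_bounded_normal_pdf (f : R -> R) : measurable_fun setT f ->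
  (forall x, `|f x| <= 1) -> mu.-integrable [set: R] (EFin \o (fun x => x * f x * p x)).
Proof.
move=> mf f1.
apply: le_integrable integrable_absM_normal_pdf => //.
  apply/measurable_EFinP; apply: measurable_funM => //.
    exact: measurable_funM.
  exact: measurable_normal_pdf.
move=> x _ /=; rewrite lee_fin !normrM normr_id ler_wpM2r ?ler_piMr ?f1//.
Qed.

Lemma measurable_affine (a c : R) : measurable_fun [set: R] (fun x : R => a * x + c).
Proof. by apply: measurable_funD => //; exact: measurable_funM. Qed.

Lemma measurable_cos_affine (a c : R) :
  measurable_fun [set: R] (fun x : R => cos (a * x + c)).
Proof.
apply: (@measurableT_comp _ _ _ _ _ _ cos); last exact: measurable_affine.
exact: continuous_measurable_fun (@continuous_cos R).
Qed.

Lemma measurable_sin_affine (a c : R) :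
  measurable_fun [set: R] (fun x : R => sin (a * x + c)).
Proof.
apply: (@measurableT_comp _ _ _ _ _ _ sin); last exact: measurable_affine.
exact: continuous_measurable_fun (@continuous_sin R).
Qed.

Lemma cos_abs_le1 (x : R) : `|cos x| <= 1.
Proof. by rewrite ler_norml cos_geN1 cos_le1. Qed.

Lemma sin_abs_le1 (x : R) : `|sin x| <= 1.
Proof. by rewrite ler_norml sin_geN1 sin_le1. Qed.

(** Stein's identity for x |-> sin (t x + c): as p' = - x p, the integrand is the derivative of [F].
    The fundamental theorem applies on [-n, n]; dominated convergence handles the integral and the
    decay of [p] the boundary terms. *)
Lemma normal_by_parts (t c : R) :
  \int[mu]_x (t * (cos (t * x + c) * p x) - x * sin (t * x + c) * p x) = 0.
Proof.
set f := fun x : R => _.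
pose F x := sin (t * x + c) * p x.
have dF (x : R) : is_derive x (1:R) (F : R -> R) (f x).
  apply: is_derive_eq.
  rewrite /f /GRing.scale/= ?mulr0 ?add0r ?addr0 ?mulr1.
  by ring.
have fi : mu.-integrable setT (EFin \o f).
  rewrite /f /comp; under eq_fun do rewrite EFinB.
  apply: integrableB => //; last first.
    exact: integrable_id_bounded_normal_pdf (measurable_sin_affine t c) (fun x => sin_abs_le1 _).
  under eq_fun do rewrite EFinM.
  apply: integrableZl => //.
  exact: integrable_bounded_normal_pdf (measurable_cos_affine t c) (fun x => cos_abs_le1 _).
have fc : continuous f.
  move=> x; apply: differentiable_continuous; apply/derivable1_diffP.
  exact: ex_derive.
have e (n : nat) : (0 < n)%N -> (\int[mu]_(x in `[(- n%:R)%R, n%:R%R]) (f x)%:E =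
    (F n%:R)%:E - (F (- n%:R)%R)%:E)%E.
  move=> n0; apply: continuous_FTC2.
  - by rewrite -subr_gt0 opprK addr_gt0// ltr0n.
  - exact: continuous_subspaceT.
  - have cF (x : R) : {for x, continuous (F : R -> R^o)}.
      by apply: differentiable_continuous; apply/derivable1_diffP; case: (dF x).
    split.
    + by move=> x _; case: (dF x).
    + exact/cvg_at_right_filter/cF.
    + exact/cvg_at_left_filter/cF.
  - by move=> x _; rewrite derive1E; exact: derive_val.
pose g (n : nat) := ((EFin \o f) \_ `[(- n%:R)%R, n%:R%R]).
have lim1 : (\int[mu]_x g n x)%E @[n --> \oo] --> (\int[mu]_x (f x)%:E)%E.
  apply: (@dominated_cvg _ _ _ mu setT _ g (EFin \o f) (abse \o (EFin \o f))) => //.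
  - move=> n; apply/(measurable_restrictT _ _).1 => //.
    exact: measurable_funS (measurable_int _ fi).
  - move=> x _; apply: cvg_near_cst; near=> n.
    rewrite /g patchE ifT// inE/= in_itv/= -ler_norml.
    near: n; exact: nbhs_infty_ger.
  - exact: integrable_abse.
  - move=> n x _; rewrite /g patchE; case: ifP => // _.
    by rewrite abse0 abse_ge0.
have lim2 : (\int[mu]_x g n x)%E @[n --> \oo] --> 0%E.
  rewrite (_ : 0%E = (0 - 0)%R%:E :> \bar R); last by rewrite subr0.
  apply: (@cvg_trans _ ((F n%:R - F (- n%:R))%:E @[n --> \oo])).
    apply: near_eq_cvg; near=> n.
    rewrite EFinB -e; last by near: n; exact: nbhs_infty_gt.
    by rewrite [LHS]integral_mkcond.
  apply: cvg_EFin; first exact: nearW.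
  have F0 (u : nat -> R) : (forall n, `|u n| = n%:R) -> F (u n) @[n --> \oo] --> (0 : R).
    move=> un; apply: norm_cvg0.
    apply: (@squeeze_cvgr _ _ _ _ (cst 0) (fun n => normal_peak 1 * 2 * harmonic n)).
    - apply: nearW => n; rewrite normr_ge0/= normrM (ger0_norm (normal_pdf_ge0 _ _ _)).
      by rewrite (le_trans _ (normal_pdf_le_harmonic (un n)))// ler_piMl ?normal_pdf_ge0 ?sin_abs_le1.
    - exact: cvg_cst.
    - rewrite -[X in _ --> X](mulr0 (normal_peak (1:R) * 2)).
      by apply: cvgMr; exact: cvg_harmonic.
  by apply: cvgB; apply: F0 => n; rewrite ?normrN normr_nat.
rewrite /Rintegral (_ : integral _ _ _ = 0%E)//.
exact: cvg_unique lim1 lim2.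
Unshelve. all: by end_near. Qed.


(** Differentiation under the integral sign and Stein's identity give psi' = - t psi; hence psi
    times exp (t^2/2) is constant, with value cos c at 0. *)
Lemma normal_cos (t c : R) :
  \int[normal_prob 0 1]_x cos (t * x + c) = cos c * expR (- (t ^+ 2 / 2)).
Proof.
pose psi t := \int[mu]_x (cos (t * x + c) * p x).
have -> : \int[normal_prob 0 1]_x cos (t * x + c) = psi t.
  apply: integral_normal_prob.
  apply: (@probability_bounded_integrable _ _ _ _ _ 1) => [|x]; last exact: cos_abs_le1.
  exact: measurable_cos_affine.
have ic s := integrable_bounded_normal_pdf (measurable_cos_affine s c) (fun x => cos_abs_le1 _).
have is_ s := integrable_id_bounded_normal_pdf (measurable_sin_affine s c) (fun x => sin_abs_le1 _).
have psi0 : psi 0 = cos c.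
  rewrite /psi; under eq_Rintegral do rewrite mul0r add0r.
  rewrite RintegralZl//; last exact: integrable_normal_pdf.
  by rewrite /Rintegral integral_normal_pdf mulr1.
have dker (s x : R) : is_derive s (1:R) (fun s : R => cos (s * x + c) * p x : R) (- (x * sin (s * x + c) * p x)).
  apply: is_derive_eq.
  rewrite /GRing.scale/= ?mulr0 ?add0r ?addr0 ?mulr1; ring.
have dpsi (s : R) : is_derive s (1:R) (psi : R -> R) (- (s * psi s)).
  have sI : `]s - 1, s + 1[%classic s.
    by rewrite /= in_itv/= ltrBlDr !ltrDl ltr01.
  have G0 (y : R) : 0 <= `|y| * p y by rewrite mulr_ge0 ?normal_pdf_ge0.
  have dd (x y : R) : `]s - 1, s + 1[%classic x -> setT y ->
      derivable (fun x : R => cos (x * y + c) * p y : R) x (1 : R).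
    by move=> _ _; case: (dker x y).
  have Gub (x y : R) : `]s - 1, s + 1[%classic x -> setT y ->
      `|partial1of2 (fun x y : R => cos (x * y + c) * p y) x y| <= `|y| * p y.
    move=> _ _; rewrite partial1of2E (@derive_val _ _ _ _ _ _ _ (dker x y)).
    rewrite normrN !normrM (ger0_norm (normal_pdf_ge0 _ _ _)) ler_wpM2r ?normal_pdf_ge0//.
    by rewrite ler_piMr ?sin_abs_le1.
  have d1 := @derivable_under_integral _ _ _ mu _ setT measurableT s (s - 1) (s + 1) sI
    (fun x _ => ic x) dd _ G0 integrable_absM_normal_pdf Gub.
  have d2 := @differentiation_under_integral _ _ _ mu _ setT measurableT s (s - 1) (s + 1) sI
    (fun x _ => ic x) dd _ G0 integrable_absM_normal_pdf Gub.
  apply: DeriveDef; first exact: d1.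
  rewrite -derive1E d2.
  have ibp := normal_by_parts s c.
  rewrite RintegralB// in ibp; last first.
    rewrite /comp; under eq_fun do rewrite EFinM.
    apply: integrableZl => //; exact: ic.
  rewrite RintegralZl// in ibp.
  transitivity (\int[mu]_x (-1 * (x * sin (s * x + c) * p x))).
    apply: eq_Rintegral => x _; rewrite partial1of2E mulN1r.
    exact: (@derive_val _ _ _ _ _ _ _ (dker s x)).
  rewrite RintegralZl// mulN1r; congr (- _).
  by apply/esym/eqP; rewrite -subr_eq0 ibp.
pose h s := psi s * expR (s ^+ 2 / 2).
have dh (s : R) : is_derive s (1:R) (h : R -> R) 0.
  apply: is_derive_eq.
  rewrite /GRing.scale/= ?mulr0 ?add0r ?addr0 ?mulr1.
  by field.
have ht : h t = h 0 := is_derive_0_is_cst t 0 dh.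
rewrite /h psi0 expr0n/= mul0r expR0 mulr1 in ht.
by rewrite -ht expRN mulfK// gt_eqF// expR_gt0.
Qed.

End normal_characteristic.

Lemma law_probability d d' (T : measurableType d) (U : measurableType d') (R : realType)
    (P : probability T R) (X : T -> U) : measurable_fun [set: T] X ->
  exists m : probability U R, forall A, m A = P (X @^-1` A).
Proof.
move=> mX.
by exists (distribution P (mfun_Sub (mem_set mX))).
Qed.

Lemma independent_Rintegral d (T : measurableType d) (R : realType)
    (P : probability T R) (X Y : T -> R) (f : R * R -> R) (M : R) :
  measurable_fun [set: T] X -> measurable_fun [set: T] Y ->
  (forall A B, measurable A -> measurable B ->
     P (X @^-1` A `&` Y @^-1` B) = (P (X @^-1` A) * P (Y @^-1` B))%E) ->
  measurable_fun [set: R * R] f -> (forall z, `|f z| <= M) ->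
  \int[P]_t f (X t, Y t) = \int[P]_s \int[P]_t f (X s, Y t).
Proof.
move=> mX mY ind mf fM.
have [m1 m1E] := law_probability P mX.
have [m2 m2E] := law_probability P mY.
have mXY : measurable_fun setT (fun t => (X t, Y t)) by exact/measurable_fun_pairP.
have c1 : 0 <= 1 :> R by [].
have pairE C : measurable C -> P ((fun t => (X t, Y t)) @^-1` C) = (m1 \x m2)%E C.
  move=> mC; have := @independent_pair_law _ _ _ P X Y m1 m2 setT (NngNum c1)
    mX mY measurableT _ C mC.
  rewrite setIT mul1e; apply => A B mA mB.
  by rewrite setIT mul1e m1E m2E ind.
rewrite (@eq_law_Rintegral _ _ _ _ _ _ _ P (m1 \x m2)%E (fun t => (X t, Y t)) id f M)//.
have [-> _] := bounded_fubini m1 m2 mf fM.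
transitivity (\int[m1]_x \int[P]_t f (x, Y t)).
  apply: eq_Rintegral => x _.
  apply: (@eq_law_Rintegral _ _ _ _ _ _ _ m2 P id Y (fun y => f (x, y)) M) => //.
  exact: measurableT_comp.
apply: (@eq_law_Rintegral _ _ _ _ _ _ _ m1 P id X (fun x => \int[P]_t f (x, Y t)) M) => //.
  (* The inner integral is a partial integral of [g] over the product of [m1] and [P], so its
     measurability comes from Fubini's theorem. *)
  pose g z := f (z.1, Y z.2).
  have mg : measurable_fun setT g.
    apply: measurableT_comp => //.
    exact: measurable_fun_pair measurable_fst (measurableT_comp mY measurable_snd).
  have gi : (m1 \x P)%E.-integrable setT (EFin \o g).
    by apply: (@probability_bounded_integrable _ _ _ (m1 \x P)%E g M) => // z; exact: fM.
  have := measurable_fubini_F gi.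
  rewrite /fubini_F /Rintegral => h.
  exact: (measurableT_comp (fine_measurable measurableT)).
move=> x.
have fi : P.-integrable setT (EFin \o (fun t => f (x, Y t))).
  apply: (@probability_bounded_integrable _ _ _ P _ M) => // t.
  by apply: measurableT_comp => //; exact: measurable_fun_pair.
apply: le_trans (le_normr_Rintegral measurableT fi) _.
rewrite -[leRHS]mulr1 -[X in _ * X](_ : fine (P setT) = 1); last first.
  by rewrite probability_setT.
rewrite -Rintegral_cst//; apply: le_Rintegral => //.
- exact: integrable_norm fi.
- by apply: (@probability_bounded_integrable _ _ _ P _ `|M|) => // t.
Qed.


(* [normal_prob] lives on [measurableTypeR R], whose display differs from that of
   [R]; product measures on [R * R] need a copy on [R]. *)
Lemma normal_law (R : realType) : exists N : probability R R,
  [/\ forall A, N A = normal_prob 0 1 A,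
      forall t c, \int[N]_x cos (t * x + c) = cos c * expR (- (t ^+ 2 / 2)) &
      forall a, 0 <= a ->
        \int[N]_x expR (- (a * x ^+ 2 / 2)) = (Num.sqrt (1 + a))^-1].
Proof.
have mid : @measurable_fun _ _ (measurableTypeR R) R setT id by [].
have [N NE] := law_probability (normal_prob (0:R) 1) mid.
exists N; split; first exact: NE.
- move=> t c; rewrite -normal_cos.
  apply: (@eq_law_Rintegral _ _ _ R (measurableTypeR R) R _ N (normal_prob (0:R) 1) id id
    (fun x => cos (t * x + c)) 1) => //.
    exact: measurable_cos_affine.
  by move=> x; exact: cos_abs_le1.
- move=> a a0; rewrite -normal_pdf_gaussian//.
  apply: (@eq_law_Rintegral _ _ _ R (measurableTypeR R) R _ N (normal_prob (0:R) 1) id id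
    (fun x => expR (- (a * x ^+ 2 / 2))) 1) => //.
    apply: measurableT_comp => //; apply: measurableT_comp => //.
    by apply: measurable_funM => //; exact: measurable_funM.
  move=> x; rewrite ger0_norm ?expR_ge0// -expR0 ler_expR oppr_le0.
  by rewrite mulr_ge0// mulr_ge0// sqr_ge0.
Qed.

(** * Gaussian vectors *)

Lemma random_vector_coord d (T : measurableType d) (R : realType) n
    (X : T -> 'cV[R]_n) (i : 'I_n) :
  random_vector X -> measurable_fun [set: T] (fun t => X t i 0).
Proof.
move=> /measurable_fun_tnthP/(_ i); congr measurable_fun.
by apply/funext => t /=; rewrite tnth_mktuple.
Qed.

Section standard_gaussian.
Context d (T : measurableType d) (R : realType) (P : probability T R) (n : nat).
Variables (W : T -> 'cV[R]_n) (a : 'I_n -> R).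
Hypothesis hW : standard_gaussian_vector P W.

Let S k t := \sum_(i < n | (i < k)%N) a i * W t i 0.

Let mW i : measurable_fun [set: T] (fun t => W t i 0).
Proof. by apply: random_vector_coord; case: hW. Qed.

Let mS k : measurable_fun [set: T] (S k).
Proof.
rewrite (_ : S k = fun t => \sum_(i < n)
    (fun (i : 'I_n) t => if (i < k)%N then a i * W t i 0 else 0) i t); last first.
  by apply/funext => t; rewrite /S big_mkcond.
apply: measurable_sum => i.
by case: (i < k)%N => //=; exact: measurable_funM.
Qed.

Let SS (k : 'I_n) t : S k.+1 t = S k t + a k * W t k 0.
Proof.
rewrite /S (bigD1 k) ?ltnSn//= addrC; congr (_ + _).
by apply: eq_bigl => i; rewrite ltnS ltn_neqAle andbC.
Qed.

Let box (A : 'I_n -> set R) := [set t | forall i, A i (W t i 0)].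

Let mbox A : (forall i, measurable (A i)) -> measurable (box A).
Proof.
move=> mA; rewrite (_ : box A = \bigcap_(i in [set: 'I_n]) ((fun t => W t i 0) @^-1` A i)).
  apply: fin_bigcap_measurable; first exact: finite_finset.
  by move=> i _; rewrite -[X in measurable X]setTI; exact: mW.
by apply/seteqP; split=> [t h i _|t h i]; [exact: h|exact: (h i I)].
Qed.

Let prodN A := (\prod_(i < n) normal_prob 0 1 (A i) : \bar R)%E.

(** The box is trivial on the coordinates already summed, so this is the independence of [S k] from
    all later coordinates. In the induction step, an event on [S k.+1] is an event on the pair
    formed by [S k] and the next coordinate, whose law inside the box is a product by the induction
    hypothesis. *)
Let partial_sum_indep k : (k <= n)%N -> forall B A, measurable B ->
  (forall i, measurable (A i)) -> (forall i : 'I_n, (i < k)%N -> A i = setT) ->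
  P (S k @^-1` B `&` box A) = (P (S k @^-1` B) * prodN A)%E.
Proof.
elim: k => [_ B A mB mA _|k IH kn B A mB mA AT].
  have S0 t : S 0 t = 0 by rewrite /S big_pred0.
  have -> : S 0 @^-1` B = [set _ | B 0] by apply/seteqP; split=> t /=; rewrite S0.
  have [B0|B0] := pselect (B 0).
    have -> : [set _ : T | B 0] = setT by apply/seteqP; split.
    by rewrite setTI probability_setT mul1e; case: hW => _; exact.
  have -> : [set _ : T | B 0] = set0 by apply/seteqP; split.
  by rewrite set0I measure0 mul0e.
pose j := Ordinal kn.
have [N [NE _ _]] := normal_law R.
have [m1 m1E] := law_probability P (mS k).
have key A' : (forall i, measurable (A' i)) -> (forall i : 'I_n, (i < k.+1)%N -> A' i = setT) ->
    P (S k.+1 @^-1` B `&` box A') =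
    (prodN A' * (m1 \x N) [set z : R * R | B (z.1 + a j * z.2)%R])%E.
  move=> mA' A'T.
  have c0 : 0 <= fine (prodN A') by rewrite fine_ge0// prode_ge0.
  have cE : ((NngNum c0)%:num%:E = prodN A')%E.
    by rewrite /= fineK// prode_fin_num// => i _; apply: fin_num_measure; exact: mA'.
  have mC : measurable [set z : R * R | B (z.1 + a j * z.2)].
    rewrite -[X in measurable X]setTI.
    suff : measurable_fun setT (fun z : R * R => z.1 + a j * z.2) by apply.
    by apply: measurable_funD => //; exact: measurable_funM.
  rewrite -cE -(@independent_pair_law _ _ _ P _ _ m1 N (box A') (NngNum c0)
    (mS k) (mW j) (mbox mA') _ _ mC).
    congr (P (_ `&` _)); apply/seteqP; split=> t /=; rewrite (SS j)//.
  move=> B1 B2 mB1 mB2.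
  (* The j-th side of [A'] is trivial, so the event on [W t j 0] can be absorbed into the box as its
     j-th side. *)
  pose A2 i := if i == j then B2 else A' i.
  rewrite (_ : _ `&` _ `&` _ = S k @^-1` B1 `&` box A2); last first.
    apply/seteqP; split=> [t [[/= h1 h2] h3]|t [/= h1 h2]].
      split => // i; rewrite /A2; case: eqVneq => [->//|_]; exact: h3.
    split; [split => //|move=> i].
      by have := h2 j; rewrite /A2 eqxx.
    have := h2 i; rewrite /A2; case: eqVneq => [->|//].
    by rewrite A'T.
  rewrite IH// ?(ltnW kn)//; last 2 first.
  - by move=> i; rewrite /A2; case: ifP.
  - move=> i ik; rewrite /A2 ifF ?A'T//; first by rewrite ltnS ltnW.
    by apply/eqP => ij; move: ik; rewrite ij/= ltnn.
  rewrite m1E cE NE muleCA; congr (_ * _)%E.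
  rewrite /prodN (bigD1 j)//= [in RHS](bigD1 j)//= /A2 eqxx A'T ?ltnSn//.
  rewrite probability_setT mul1e muleC; congr (_ * _)%E.
  by apply: eq_bigr => i /negbTE ->.
(* With the trivial box, [key] identifies the product-measure factor as the probability that
   [S k.+1] lies in [B]. *)
have PT := key (fun=> setT) (fun=> measurableT) (fun _ _ => erefl).
rewrite (key A mA AT) muleC; congr (_ * _)%E.
move: PT; rewrite /prodN big1 => [|i _]; last exact: probability_setT.
rewrite mul1e => <-; congr (P _).
by apply/seteqP; split=> t //= [].
Qed.

Let boxj (j : 'I_n) B : (fun t => W t j 0) @^-1` B =
  box (fun i => if i == j then B else setT).
Proof.
apply/seteqP; split=> t /= => [h i|/(_ j)]; last by rewrite eqxx.
by case: eqVneq => // ->.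
Qed.

Let prodNj (j : 'I_n) B : prodN (fun i => if i == j then B else setT) = normal_prob 0 1 B.
Proof.
rewrite /prodN (bigD1 j)//= eqxx big1 ?mule1// => i /negbTE ->.
exact: probability_setT.
Qed.

Let mboxj (j : 'I_n) B : measurable B ->
  forall i, measurable ((fun i : 'I_n => if i == j then B else [set: R]) i).
Proof. by move=> mB i /=; case: ifP. Qed.

Let cos_partial_sum k (c : R) : (k <= n)%N ->
  \int[P]_t cos (S k t + c) =
  cos c * expR (- ((\sum_(i < n | (i < k)%N) a i ^+ 2) / 2)).
Proof.
elim: k c => [|k IH] c kn.
  under eq_Rintegral do rewrite /S big_pred0// add0r.
  by rewrite Rintegral_probability_cst big_pred0// mul0r oppr0 expR0 mulr1.
pose j := Ordinal kn.
have [N [NE Ncos _]] := normal_law R.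
have WN B : measurable B -> P ((fun t => W t j 0) @^-1` B) = N B.
  by move=> mB; case: hW => _ h; rewrite boxj NE -(prodNj j); apply: h; exact: mboxj.
pose f (z : R * R) := cos (z.1 + a j * z.2 + c).
transitivity (\int[P]_t f (S k t, W t j 0)).
  by apply: eq_Rintegral => t _; rewrite /= (SS j).
rewrite [LHS](@independent_Rintegral _ _ _ P (S k) (fun t => W t j 0) f 1 (mS k) (mW j)); first last.
- by move=> z; exact: cos_abs_le1.
- apply: (@measurableT_comp _ _ _ _ _ _ cos).
    exact: continuous_measurable_fun (@continuous_cos R).
  apply: measurable_funD => //; apply: measurable_funD => //.
  exact: measurable_funM.
- move=> A B mA mB; rewrite WN// boxj partial_sum_indep ?(ltnW kn) ?prodNj ?NE//.
    exact: mboxj.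
  by move=> i ik; rewrite ifF//; apply/eqP => ij; move: ik; rewrite ij/= ltnn.
transitivity (\int[P]_t (cos (S k t + c) * expR (- (a j ^+ 2 / 2)))).
  (* For the integral over the new coordinate, the partial sum [S k s + c] is a mere phase. *)
  apply: eq_Rintegral => s _ /=; rewrite -Ncos.
  rewrite -(@eq_law_Rintegral _ _ _ _ _ _ _ P N (fun t => W t j 0) id
    (fun x => cos (a j * x + (S k s + c))) 1)//.
  - by apply: eq_Rintegral => t _; rewrite /f/= addrCA addrA.
  - exact: measurable_cos_affine.
  - by move=> x; exact: cos_abs_le1.
rewrite RintegralZr//; last first.
  apply: (@probability_bounded_integrable _ _ _ _ _ 1) => [|t]; last exact: cos_abs_le1.
  apply: (@measurableT_comp _ _ _ _ _ _ cos).
    exact: continuous_measurable_fun (@continuous_cos R).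
  exact: measurable_funD.
rewrite IH ?(ltnW kn)// -mulrA -expRD; congr (_ * expR _).
rewrite [in RHS](bigD1 j) ?ltnSn//=.
rewrite [in RHS](eq_bigl (fun i : 'I_n => (i < k)%N)); first by field.
by move=> i; rewrite ltnS [in RHS]ltn_neqAle andbC.
Qed.

Lemma standard_gaussian_cos (c : R) :
  \int[P]_t cos (\sum_i a i * W t i 0 + c) =
  cos c * expR (- ((\sum_i a i ^+ 2) / 2)).
Proof.
have e (F : 'I_n -> R) : \sum_(i < n | (i < n)%N) F i = \sum_i F i.
  by apply: eq_bigl => i; rewrite ltn_ord.
rewrite -(e (fun i => a i ^+ 2)) -cos_partial_sum//.
by apply: eq_Rintegral => t _; rewrite /S e.
Qed.

End standard_gaussian.

(** * Second moments from characteristic functions *)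

Section second_moment.
Context {R : realType}.

Lemma sin_abs_le (x : R) : `|sin x| <= `|x|.
Proof.
wlog x0 : x / 0 < x.
  move=> h; have [/h//|x0|<-] := ltgtP 0 x; last by rewrite sin0.
  by rewrite -[leLHS]normrN -[leRHS]normrN -sinN h// oppr_gt0.
have [c _] := @MVT R sin cos 0 x x0 (fun y _ => is_derive_sin y)
  (continuous_subspaceT (@continuous_sin R)).
rewrite sin0 !subr0 => ->.
by rewrite normrM ler_piMl ?cos_abs_le1.
Qed.

Lemma half_angle (x : R) : 1 - cos x = 2 * sin (x / 2) ^+ 2.
Proof.
have {1}-> : x = (x / 2) *+ 2 by field.
rewrite cos_mulr2n cos2sin2; ring.
Qed.

Lemma cvg_difference_quotient (g : R -> R) (l : R) (u : nat -> R) :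
  is_derive (0:R) (1:R) (g : R -> R) l -> g 0 = 0 ->
  (forall n, u n != 0) -> u n @[n --> \oo] --> (0:R) ->
  (u n)^-1 * g (u n) @[n --> \oo] --> l.
Proof.
move=> gl g0 un u0.
have /cvg_ex[/= k hk] : derivable (g : R -> R) 0 1 by case: gl.
have kl : k = l.
  rewrite -(@derive_val _ _ _ _ _ _ _ gl); apply/esym/cvg_lim => //; exact: hk.
rewrite kl in hk.
move/cvgr_dnbhsP : hk => /(_ u (conj un u0)).
apply: cvg_trans; apply: near_eq_cvg; apply: nearW => n /=.
by rewrite g0 subr0 addr0 /GRing.scale/= mulr1.
Qed.

(** The functions [f n] = 2 (1 - cos (q X)) / q^2, with q = 1/(n+1), tend to X^2 from below, and
    their means tend to [v]. Fatou's lemma bounds the second moment by [v] from above, the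
    inequality f n <= X^2 from below, with no prior integrability of X^2. *)
Lemma second_moment d (T : measurableType d) (P : probability T R) (X : T -> R) (v : R) :
  measurable_fun [set: T] X ->
  (forall s, \int[P]_t cos (s * X t) = expR (- (s ^+ 2 * v / 2))) ->
  (\int[P]_t (X t ^+ 2)%:E = v%:E)%E.
Proof.
move=> mX hX.
pose q (n : nat) : R := n.+1%:R^-1.
have q0 n : q n != 0 by rewrite invr_eq0 pnatr_eq0.
have qcvg : q n @[n --> \oo] --> (0 : R) by exact: cvg_harmonic.
pose f n t := 2 * (q n ^+ 2)^-1 * (1 - cos (q n * X t)).
(* As the square of a difference quotient of y |-> 2 sin (y X / 2) at 0, [f n] is visibly
   nonnegative, at most X^2, and convergent to X^2. *)
have fE n t : f n t = ((q n)^-1 * (2 * sin (q n * X t / 2))) ^+ 2.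
  by rewrite /f half_angle -exprVn; ring.
have f_ge0 n t : 0 <= f n t by rewrite fE sqr_ge0.
have f_le n t : f n t <= X t ^+ 2.
  rewrite fE -[leLHS]real_normK ?num_real// -[leRHS]real_normK ?num_real//.
  rewrite ler_sqr ?nnegrE// normrM normfV ler_pdivrMl ?normr_gt0//.
  rewrite -normrM [X in _ <= `|X|](_ : q n * X t = 2 * (q n * X t / 2)); last by field.
  by rewrite normrM [leRHS]normrM ler_wpM2l// sin_abs_le.
have f_cvg t : f n t @[n --> \oo] --> X t ^+ 2.
  under eq_fun do rewrite fE.
  rewrite expr2; under eq_fun do rewrite expr2.
  suff h : (q n)^-1 * (2 * sin (q n * X t / 2)) @[n --> \oo] --> X t by exact: cvgM.
  apply: (@cvg_difference_quotient (fun y => 2 * sin (y * X t / 2))) => //; last first.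
    by rewrite !mul0r sin0 mulr0.
  apply: is_derive_eq.
  rewrite /GRing.scale/= ?mulr0 ?mul0r ?add0r ?addr0 ?mulr1 cos0.
  by field.
have mcos n : measurable_fun setT (fun t => cos (q n * X t)).
  apply: (@measurableT_comp _ _ _ _ _ _ cos).
    exact: continuous_measurable_fun (@continuous_cos R).
  exact: measurable_funM.
have mf n : measurable_fun setT (f n).
  by apply: measurable_funM => //; exact: measurable_funB.
have Ef n : (\int[P]_t (f n t)%:E =
    (2 * (q n ^+ 2)^-1 * (1 - expR (- (q n ^+ 2 * v / 2))))%:E)%E.
  have ic : P.-integrable setT (EFin \o (fun t => cos (q n * X t))).
    by apply: (@probability_bounded_integrable _ _ _ _ _ 1) => // t; exact: cos_abs_le1.
  have i1 : P.-integrable setT (EFin \o (fun t => 1 - cos (q n * X t))).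
    apply: (@probability_bounded_integrable _ _ _ _ _ 2) => [|t].
      exact: measurable_funB.
    rewrite (le_trans (ler_normB _ _))// normr1.
    by rewrite -[leRHS](_ : 1 + 1 = 2)// lerD2l cos_abs_le1.
  have fi : P.-integrable setT (EFin \o f n).
    by rewrite /f /comp; under eq_fun do rewrite EFinM; exact: integrableZl.
  rewrite -[LHS]fineK; last exact: integrable_fin_num.
  congr EFin.
  rewrite -[LHS]/(\int[P]_t f n t) /f RintegralZl// RintegralB//.
    by rewrite hX Rintegral_probability_cst.
  apply: (@probability_bounded_integrable _ _ _ _ _ 1) => // t.
  by rewrite normr1.
have Ecvg : (2 * (q n ^+ 2)^-1 * (1 - expR (- (q n ^+ 2 * v / 2)))) @[n --> \oo] --> v.
  have h : (q n ^+ 2)^-1 * (2 * (1 - expR (- (q n ^+ 2 * v / 2)))) @[n --> \oo] --> v.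
    (* The quotient is taken in the variable y = q^2, in which the exponential has derivative [v] at
       0 after scaling. *)
    apply: (@cvg_difference_quotient (fun y => 2 * (1 - expR (- (y * v / 2)))) _ (fun n => q n ^+ 2)).
    - apply: is_derive_eq.
      rewrite /GRing.scale/= ?mulr0 ?mul0r ?oppr0 ?expR0 ?add0r ?addr0 ?mulr1.
      by field.
    - by rewrite !mul0r oppr0 expR0 subrr mulr0.
    - by move=> n; rewrite expf_eq0 /= q0.
    - rewrite -[X in _ --> X](mulr0 (0:R)); under eq_fun do rewrite expr2.
      exact: cvgM.
  apply: cvg_trans h; apply: near_eq_cvg; apply: nearW => n /=.
  by ring.
have Ecvg' : (\int[P]_t (f n t)%:E)%E @[n --> \oo] --> v%:E.
  by under eq_fun do rewrite Ef; apply: cvg_EFin => //; exact: nearW.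
have mX2 : measurable_fun setT (fun t => (X t ^+ 2)%:E).
  exact/measurable_EFinP/measurable_funX.
apply/eqP; rewrite eq_le; apply/andP; split.
  have := @fatou _ _ _ P setT measurableT (fun n t => (f n t)%:E)
    (fun n => (measurable_EFinP _ _).2 (mf n)) (fun n t _ => f_ge0 n t).
  rewrite (cvg_limn_einf_sup Ecvg').1; apply: le_trans.
  rewrite le_eqVlt; apply/orP; left; apply/eqP; apply: eq_integral => t _.
  have h : (f n t)%:E @[n --> \oo] --> (X t ^+ 2)%:E.
    by apply: cvg_EFin; [exact: nearW|exact: f_cvg].
  by rewrite (cvg_limn_einf_sup h).1.
rewrite -(cvg_lim _ Ecvg')//; apply: lime_le.
- by apply/cvg_ex; exists v%:E.
- apply: nearW => n; apply: ge0_le_integral => //.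
  + by move=> t _; rewrite lee_fin.
  + exact/measurable_EFinP.
  + by move=> t _; rewrite lee_fin f_le.
Qed.

End second_moment.

(** * The Laplace transform of the squared modulus *)

Section laplace.
Context d (T : measurableType d) (R : realType) (P : probability T R).
Variables (X Y : T -> R) (S : R).
Hypotheses (mX : measurable_fun [set: T] X) (mY : measurable_fun [set: T] Y).
Hypothesis S0 : 0 <= S.
Hypothesis XY_cos : forall a b,
  \int[P]_t cos (a * X t + b * Y t) = expR (- ((a ^+ 2 + b ^+ 2) * S / 4)).
Variable l : R.
Hypothesis l0 : 0 <= l.

(** With s^2 = 2 l, the average of cos (s X x) over a standard normal x is exp (- l X^2). *)
Let s := Num.sqrt (2 * l).

Let s2 : s ^+ 2 = 2 * l. Proof. by rewrite sqr_sqrtr// mulr_ge0. Qed.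

Let gauss_le1 (x : R) : 0 <= x -> `|expR (- x)| <= 1.
Proof. by move=> x0; rewrite ger0_norm ?expR_ge0// -expR0 ler_expR oppr_le0. Qed.

Let mexp (Z : T -> R) : measurable_fun [set: T] Z ->
  measurable_fun [set: T] (fun t => expR (- (l * Z t ^+ 2))).
Proof.
move=> mZ; apply: measurableT_comp => //; apply: measurableT_comp => //.
by apply: measurable_funM => //; exact: measurable_funX.
Qed.

Let sl_eq (x y : R) : x ^+ 2 = y -> expR (- ((s * x) ^+ 2 / 2)) = expR (- (l * y)).
Proof. by move=> <-; congr expR; rewrite exprMn s2; field. Qed.

(** Only X is averaged out here; the factor cos (b Y) is kept so that the same device can be applied
    to Y afterwards. *)
Let half_laplace b : \int[P]_t (cos (b * Y t) * expR (- (l * X t ^+ 2))) =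
  expR (- (b ^+ 2 * S / 4)) / Num.sqrt (1 + l * S).
Proof.
have [N [_ Ncos Nexp]] := normal_law R.
transitivity (\int[P]_t \int[N]_x cos ((s * X t) * x + b * Y t)).
  by apply: eq_Rintegral => t _; rewrite Ncos (@sl_eq _ (X t ^+ 2)).
pose f (z : T * R) := cos ((s * X z.1) * z.2 + b * Y z.1).
have mf : measurable_fun setT f.
  apply: (@measurableT_comp _ _ _ _ _ _ cos).
    exact: continuous_measurable_fun (@continuous_cos R).
  apply: measurable_funD; apply: measurable_funM => //.
    apply: measurable_funM => //; exact: measurableT_comp.
  exact: measurableT_comp.
have [_ ] := bounded_fubini P N mf (fun z => cos_abs_le1 _).
rewrite /f/= => ->.
transitivity (\int[N]_x (expR (- (b ^+ 2 * S / 4)) * expR (- ((l * S) * x ^+ 2 / 2)))).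
  apply: eq_Rintegral => x _; rewrite -expRD.
  under eq_Rintegral do rewrite mulrAC.
  rewrite XY_cos exprMn s2; congr expR; by field.
rewrite RintegralZl//; last first.
  apply: (@probability_bounded_integrable _ _ _ _ _ 1) => [|x].
    apply: measurableT_comp => //; apply: measurableT_comp => //.
    by apply: measurable_funM => //; exact: measurable_funM.
  by apply: gauss_le1; apply: mulr_ge0 => //; apply: mulr_ge0; [exact: mulr_ge0|exact: sqr_ge0].
by rewrite Nexp// mulr_ge0.
Qed.

(** Taking b = s x in [half_laplace] leaves the factor exp (- l S x^2 / 2), whose normal average
    supplies the second factor (1 + l S)^(-1/2). *)
Lemma laplace_sum_sqr :
  \int[P]_t expR (- (l * (X t ^+ 2 + Y t ^+ 2))) = (1 + l * S)^-1.
Proof.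
have [N [_ Ncos Nexp]] := normal_law R.
have lS : 0 < 1 + l * S by rewrite ltr_pwDl// mulr_ge0.
transitivity (\int[P]_t \int[N]_x (expR (- (l * X t ^+ 2)) * cos ((s * Y t) * x + 0))).
  apply: eq_Rintegral => t _; rewrite RintegralZl//; last first.
    apply: (@probability_bounded_integrable _ _ _ _ _ 1) => [|x].
      exact: measurable_cos_affine.
    exact: cos_abs_le1.
  by rewrite Ncos cos0 mul1r (@sl_eq _ (Y t ^+ 2))// -expRD -opprD -mulrDr.
pose f (z : T * R) := expR (- (l * X z.1 ^+ 2)) * cos ((s * Y z.1) * z.2 + 0).
have mf : measurable_fun setT f.
  apply: measurable_funM.
    exact: (measurableT_comp (mexp mX)).
  apply: (@measurableT_comp _ _ _ _ _ _ cos).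
    exact: continuous_measurable_fun (@continuous_cos R).
  apply: measurable_funD => //; apply: measurable_funM => //.
  apply: measurable_funM => //; exact: measurableT_comp.
have f1 z : `|f z| <= 1.
  by rewrite normrM mulr_ile1// ?cos_abs_le1// gauss_le1// mulr_ge0// sqr_ge0.
have [_ ] := bounded_fubini P N mf f1.
rewrite /f/= => ->.
transitivity (\int[N]_x ((Num.sqrt (1 + l * S))^-1 * expR (- ((l * S) * x ^+ 2 / 2)))).
  apply: eq_Rintegral => x _.
  transitivity (\int[P]_t (cos ((s * x) * Y t) * expR (- (l * X t ^+ 2)))).
    by apply: eq_Rintegral => t _; rewrite addr0 mulrC mulrAC.
  rewrite half_laplace mulrC exprMn s2; congr (_ * expR _); by field.
rewrite RintegralZl//; last first.
  apply: (@probability_bounded_integrable _ _ _ _ _ 1) => [|x].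
    apply: measurableT_comp => //; apply: measurableT_comp => //.
    by apply: measurable_funM => //; exact: measurable_funM.
  by apply: gauss_le1; apply: mulr_ge0 => //; apply: mulr_ge0; [exact: mulr_ge0|exact: sqr_ge0].
by rewrite Nexp ?mulr_ge0// -invfM -expr2 sqr_sqrtr// ltW.
Qed.

End laplace.

(** * Bernstein polynomials of a step function *)

Section bernstein.
Context {R : realType}.

(* [(bernstein n f).[u]] is the mean of [f] under the binomial law with
   parameters [n] and [u], computed by conditioning on the first trial. *)
Fixpoint bernstein (n : nat) (f : nat -> R) : {poly R} :=
  if n is n'.+1 then
    'X * bernstein n' (fun k => f k.+1) + (1 - 'X) * bernstein n' f
  else (f 0%N)%:P.

Lemma bernsteinS n f (u : R) : (bernstein n.+1 f).[u] =
  u * (bernstein n (fun k => f k.+1)).[u] + (1 - u) * (bernstein n f).[u].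
Proof. by rewrite /= !hornerE. Qed.

Lemma le_bernstein n f g (u : R) : 0 <= u <= 1 -> (forall k, f k <= g k) ->
  (bernstein n f).[u] <= (bernstein n g).[u].
Proof.
move=> /andP[u0 u1]; elim: n f g => [|n IH] f g fg; first by rewrite /= !hornerE.
by rewrite !bernsteinS lerD// ler_wpM2l ?subr_ge0// IH.
Qed.

Lemma bernstein_affine n f (a b u : R) :
  (bernstein n (fun k => a * f k + b)).[u] = a * (bernstein n f).[u] + b.
Proof.
elim: n f => [|n IH] f; first by rewrite /= !hornerE.
by rewrite !bernsteinS !IH; ring.
Qed.

(** Variance plus squared bias of a binomial variable about [a]. The centre is arbitrary because a
    success in the leading trial moves it to a - 1 in the induction. *)
Lemma bernstein_variance n (a u : R) :
  (bernstein n (fun k => (k%:R - a) ^+ 2)).[u] = n%:R * u * (1 - u) + (n%:R * u - a) ^+ 2.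
Proof.
elim: n a => [|n IH] a; first by rewrite /= !hornerE; ring.
have e : (fun k => (k.+1%:R - a) ^+ 2) = (fun k => (k%:R - (a - 1)) ^+ 2) :> (nat -> R).
  by apply/funext => k; rewrite -natr1; ring.
by rewrite bernsteinS e !IH -natr1; ring.
Qed.

Definition le_indicator (c : R) (k : nat) : R := (k%:R <= c)%R%:R.

(** Chebyshev's inequality for the binomial law: [q] is at least 1 as soon as k is n e away from n
    u, and its mean u (1 - u) / (n e^2) is at most 1 / (n e^2). The step function lies above 1 - q
    in one case and below q in the other. *)
Lemma bernstein_le_indicator n (c u e : R) : (0 < n)%N -> 0 <= u <= 1 -> 0 < e ->
  (u + e <= c -> 1 - (n%:R * e ^+ 2)^-1 <= (bernstein n (le_indicator (n%:R * c))).[u]) /\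
  (c + e <= u -> (bernstein n (le_indicator (n%:R * c))).[u] <= (n%:R * e ^+ 2)^-1).
Proof.
move=> n0 u01 e0; have /andP[u0 u1] := u01.
have nR : 0 < n%:R :> R by rewrite ltr0n.
pose q k : R := (n%:R * e) ^- 2 * (k%:R - n%:R * u) ^+ 2.
have qE : (bernstein n q).[u] <= (n%:R * e ^+ 2)^-1.
  rewrite (_ : q = fun k => (n%:R * e) ^- 2 * (k%:R - n%:R * u) ^+ 2 + 0); last first.
    by apply/funext => k; rewrite addr0.
  rewrite (bernstein_affine _ (fun k => (k%:R - n%:R * u) ^+ 2)) addr0.
  rewrite bernstein_variance subrr expr0n addr0 ler_pdivrMl ?exprn_gt0 ?mulr_gt0//.
  rewrite (_ : _ / _ = n%:R * 1); last by field; rewrite !gt_eqF.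
  rewrite -mulrA ler_wpM2l//; nra.
have q1 k : n%:R * e <= `|k%:R - n%:R * u| -> 1 <= q k.
  move=> h; rewrite /q ler_pdivlMl ?exprn_gt0 ?mulr_gt0// mulr1.
  by rewrite -[leRHS]real_normK ?num_real// ler_sqr ?nnegrE// mulr_ge0// ltW.
have q0 k : 0 <= q k by rewrite mulr_ge0 ?sqr_ge0// invr_ge0 sqr_ge0.
split=> h.
  apply: (@le_trans _ _ (bernstein n (fun k => -1 * q k + 1)).[u]).
    by rewrite bernstein_affine mulN1r [leRHS]addrC lerD2l lerN2.
  apply: le_bernstein => // k; rewrite /le_indicator /=; case: (leP k%:R (n%:R * c)) => kc.
    by rewrite mulN1r gerDr oppr_le0.
  rewrite mulN1r addrC subr_le0 q1// ger0_norm.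
    rewrite lerBrDr -mulrDr (le_trans _ (ltW kc))// ler_wpM2l//; lra.
  rewrite subr_ge0 (le_trans _ (ltW kc))// ler_wpM2l//; lra.
apply: le_trans qE; apply: le_bernstein => // k; rewrite /le_indicator /=; case: (leP k%:R (n%:R * c)) => kc//.
rewrite q1// ler0_norm.
  rewrite opprB lerBrDr -lerBrDl; rewrite (le_trans kc)// -mulrBr ler_wpM2l//; lra.
rewrite subr_le0 (le_trans kc)// ler_wpM2l//; lra.
Qed.

End bernstein.

(** * Laws on the unit interval are determined by their moments *)

Section moments.
Context d1 (T1 : measurableType d1) d2 (T2 : measurableType d2) (R : realType).
Variables (P : probability T1 R) (Q : probability T2 R).
Variables (U : T1 -> R) (V : T2 -> R).
Hypotheses (mU : measurable_fun [set: T1] U) (mV : measurable_fun [set: T2] V).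
Hypotheses (U01 : forall t, 0 <= U t <= 1) (V01 : forall t, 0 <= V t <= 1).
Hypothesis UV : forall k, \int[P]_t U t ^+ k = \int[Q]_t V t ^+ k.

Let integrable_power d (T : measurableType d) (m : probability T R) (X : T -> R) k :
  measurable_fun [set: T] X -> (forall t, 0 <= X t <= 1) ->
  m.-integrable [set: T] (EFin \o (fun t => X t ^+ k)).
Proof.
move=> mX X01; apply: (@probability_bounded_integrable _ _ _ _ _ 1) => [|t].
  exact: measurable_funX.
have /andP[x0 x1] := X01 t.
by rewrite ger0_norm ?exprn_ge0// exprn_ile1.
Qed.

Let integrable_poly d (T : measurableType d) (m : probability T R) (X : T -> R) (p : {poly R}) :
  measurable_fun [set: T] X -> (forall t, 0 <= X t <= 1) ->
  m.-integrable [set: T] (EFin \o (fun t => p.[X t])).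
Proof.
move=> mX X01; rewrite /comp.
under eq_fun do rewrite horner_coef -sumEFin.
apply: integrable_sum => // i _; under eq_fun do rewrite EFinM.
by apply: integrableZl => //; exact: integrable_power.
Qed.

Let Rintegral_poly d (T : measurableType d) (m : probability T R) (X : T -> R) (p : {poly R}) :
  measurable_fun [set: T] X -> (forall t, 0 <= X t <= 1) ->
  \int[m]_t p.[X t] = \sum_(i < size p) p`_i * \int[m]_t X t ^+ i.
Proof.
move=> mX X01; under eq_Rintegral do rewrite horner_coef.
rewrite Rintegral_sum => [|i]; last first.
  rewrite /comp; under eq_fun do rewrite EFinM.
  by apply: integrableZl => //; exact: integrable_power.
by apply: eq_bigr => i _; rewrite RintegralZl//; exact: integrable_power.
Qed.

Let Rintegral_indicator d (T : measurableType d) (m : probability T R) (A : set T) :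
  measurable A -> \int[m]_t \1_A t = fine (m A).
Proof. by move=> mA; rewrite /Rintegral integral_indic// setIT. Qed.

Let integrable_indicator d (T : measurableType d) (m : probability T R) (A : set T) r :
  measurable A -> m.-integrable [set: T] (EFin \o (fun t => \1_A t + r)).
Proof.
move=> mA; apply: (@probability_bounded_integrable _ _ _ _ _ (1 + `|r|)) => [|t].
  by apply: measurable_funD => //; exact: measurable_indic.
rewrite (le_trans (ler_normD _ _))// lerD2r ger0_norm ?indicE//.
by case: (_ \in _).
Qed.

(** The Bernstein polynomial of the step at the midpoint [c] is within [r] of 1 on [0, a] and within
    [r] of 0 on [b, 1]; nothing is known near [c], hence the gap between [a] and [b]. Its mean
    depends on the moments only, and the error 2 r tends to 0 with n. *)
Lemma moments_tail_le (a b : R) : a < b ->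
  (P [set t | (U t <= a)%R] <= Q [set t | (V t < b)%R])%E.
Proof.
move=> ab; pose e := (b - a) / 2; pose c := a + e.
have e0 : 0 < e by rewrite divr_gt0// subr_gt0.
have mA : measurable [set t | U t <= a].
  rewrite -[X in measurable X]setTI; exact: measurable_fun_le.
have mB : measurable [set t | V t < b].
  rewrite (_ : [set t | _] = setT `&` V @^-1` `]-oo, b[); first exact: mV.
  by rewrite setTI; apply/seteqP; split=> t /=; rewrite in_itv.
have key (n : nat) : (0 < n)%N ->
    fine (P [set t | U t <= a]) <= fine (Q [set t | V t < b]) + 2 * (n%:R * e ^+ 2)^-1.
  move=> n0; set r := (_ * _)^-1.
  have r0 : 0 <= r by rewrite invr_ge0 mulr_ge0// sqr_ge0.
  pose p := bernstein n (le_indicator (n%:R * c)).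
  (* Constants are reproduced, so monotonicity also gives 0 <= p <= 1 on the unit interval. *)
  have cstE (x y : R) : (bernstein n (fun=> x)).[y] = x.
    rewrite (_ : (fun=> x) = (fun _ : nat => 0 * (0 : R) + x)).
      by rewrite (bernstein_affine n (fun=> 0)) mul0r add0r.
    by apply/funext => k; rewrite mul0r add0r.
  have pU : fine (P [set t | U t <= a]) - r <= \int[P]_t p.[U t].
    rewrite -Rintegral_indicator// -[X in _ - X](Rintegral_probability_cst P) -RintegralB//; first last.
    (* The empty set yields the integrability of the constant [r]. *)
    - by have := @integrable_indicator _ _ P set0 r measurable0; under eq_fun do rewrite indic0 add0r.
    - by have := @integrable_indicator _ _ P _ 0 mA; under eq_fun do rewrite addr0.
    apply: le_Rintegral => //.
    - exact: integrable_indicator.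
    - exact: integrable_poly.
    move=> t _; rewrite indicE; have [|] := boolP (t \in _).
      rewrite inE/= => Ua; apply: (bernstein_le_indicator c n0 (U01 t) e0).1.
      by rewrite /c lerD2r.
    move=> _; rewrite sub0r (@le_trans _ _ 0)// ?oppr_le0//.
    rewrite -(cstE 0 (U t)); apply: le_bernstein => //.
  have pV : \int[Q]_t p.[V t] <= fine (Q [set t | V t < b]) + r.
    rewrite -Rintegral_indicator// -[X in _ + X](Rintegral_probability_cst Q) -RintegralD//; first last.
    - by have := @integrable_indicator _ _ Q set0 r measurable0; under eq_fun do rewrite indic0 add0r.
    - by have := @integrable_indicator _ _ Q _ 0 mB; under eq_fun do rewrite addr0.
    apply: le_Rintegral => //.
    - exact: integrable_poly.
    - exact: integrable_indicator.
    move=> t _; rewrite indicE; have [|] := boolP (t \in _).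
      move=> _; rewrite (@le_trans _ _ 1)// ?lerDl//.
      rewrite -[leRHS](cstE 1 (V t)); apply: le_bernstein => // k.
      by rewrite /le_indicator /= lern1 leq_b1.
    rewrite notin_setE/= => /negP; rewrite -leNgt => bV; rewrite add0r.
    apply: (bernstein_le_indicator c n0 (V01 t) e0).2.
    by rewrite (le_trans _ bV)// /c /e; lra.
  have pUV : \int[P]_t p.[U t] = \int[Q]_t p.[V t].
    by rewrite !Rintegral_poly//; apply: eq_bigr => i _; rewrite UV.
  move: pU; rewrite pUV => pU; have := le_trans pU pV.
  lra.
rewrite -[leLHS]fineK ?fin_num_measure// -[leRHS]fineK ?fin_num_measure// lee_fin.
apply/ler_addgt0Pr => x x0.
pose n := (Num.bound (2 / (e ^+ 2 * x))).+1.
apply: le_trans (key n isT) _; rewrite lerD2l.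
have ex0 : 0 < e ^+ 2 * x by rewrite mulr_gt0// exprn_gt0.
have : 2 / (e ^+ 2 * x) <= n%:R.
  apply: (@le_trans _ _ (Num.bound (2 / (e ^+ 2 * x)))%:R); last by rewrite ler_nat.
  by apply/ltW/archi_boundP; rewrite divr_ge0// ltW.
have ne0 : 0 < n%:R * e ^+ 2 by rewrite pmulr_rgt0 ?ltr0n// exprn_gt0.
rewrite !ler_pdivrMr// => h.
by rewrite mulrC -mulrA.
Qed.

End moments.

(** * The exponential tail *)

Section exponential_tail.
Context {R : realType}.
Notation mu := (@lebesgue_measure R).

(** The absolute value keeps exp (- |y|) in [0, 1] for all real y and changes nothing on the
    support. Multiplying the density of rate r by exp (- k y) gives r / (r + k) times the density of
    rate r + k. *)
Lemma exponential_law (r : R) : 0 < r -> exists Q : probability (measurableTypeR R) R,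
  (forall A, measurable A -> Q A = exponential_prob r A) /\
  forall k : nat, \int[Q]_y (expR (- `|y|) ^+ k) = r / (r + k%:R).
Proof.
move=> r0.
have [Q QE] : exists Q : probability (measurableTypeR R) R, forall A, Q A = exponential_prob r A.
  by unshelve eexists (exponential_prob r).
exists Q; split=> [A _|k]; first exact: QE.
rewrite (@Rintegral_density _ Q (exponential_pdf r)); first last.
- apply: (@probability_bounded_integrable _ _ _ _ _ 1) => [|y].
    apply: measurable_funX; apply: measurableT_comp => //.
    apply: measurableT_comp => //; exact: normr_measurable.
  have e1 : expR (- `|y|) <= 1 by rewrite -expR0 ler_expR oppr_le0.
  by rewrite ger0_norm ?exprn_ge0 ?expR_ge0// exprn_ile1 ?expR_ge0.
- by move=> A _; rewrite QE.
- exact: integrable_exponential_pdf.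
have rk0 : 0 < r + k%:R by rewrite ltr_pwDl.
transitivity (\int[mu]_y (r / (r + k%:R) * exponential_pdf (r + k%:R) y)).
  apply: eq_Rintegral => y _; have [y0|y0] := ltP y 0.
    by rewrite !lt0_exponential_pdf// !mulr0.
  rewrite !exponential_pdfE// [in RHS]mulrA divfK ?gt_eqF// ger0_norm//.
  rewrite -expRM_natl mulrCA -expRD; congr (_ * expR _).
  by ring.
rewrite RintegralZl//; last exact: integrable_exponential_pdf.
by rewrite /Rintegral integral_exponential_pdf ?mulr1.
Qed.

Lemma measurable_abs_tail (x : R) :
  measurable ([set y | x < `|y|] : set (measurableTypeR R)) /\
  measurable ([set y | x <= `|y|] : set (measurableTypeR R)).
Proof.
have mn : measurable_fun [set: measurableTypeR R] (@Num.norm R R) := @normr_measurable R setT.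
rewrite (_ : [set y | x < _] = setT `&` @Num.norm R R @^-1` `]x, +oo[); last first.
  by rewrite setTI; apply/seteqP; split=> t /=; rewrite in_itv/= andbT.
rewrite (_ : [set y | x <= _] = setT `&` @Num.norm R R @^-1` `[x, +oo[); last first.
  by rewrite setTI; apply/seteqP; split=> t /=; rewrite in_itv/= andbT.
by split; exact: mn.
Qed.

(** Both sets are compared with the complement of [0, x], from which they differ at most by negative
    reals, a null set, and by the points of modulus x. One-sided bounds suffice for the squeeze
    below. *)
Lemma exponential_prob_tail (r x : R) (Q : probability (measurableTypeR R) R) : 0 < r -> 0 < x ->
  (forall A, measurable A -> Q A = exponential_prob r A) ->
  fine (Q [set y | x < `|y|]) <= expR (- (r * x)) /\
  expR (- (r * x)) <= fine (Q [set y | x <= `|y|]).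
Proof.
move=> r0 x0 QE.
have Q0x : Q `[0, x]%classic = (1 - expR (- (r * x)))%:E.
  by rewrite QE ?exponential_prob_itv0c// mulNr.
have Qneg : Q `]-oo, 0[%classic = 0%E.
  rewrite QE// /exponential_prob integral0_eq// => y /=; rewrite in_itv/= => y0.
  by rewrite lt0_exponential_pdf.
have Qsplit : Q (~` `[0, x]%classic) = (expR (- (r * x)))%:E.
  rewrite probability_setC// Q0x -EFinB; congr EFin; ring.
have [mgt mge] := measurable_abs_tail x.
split.
  rewrite -lee_fin -Qsplit fineK ?fin_num_measure//; apply: le_measure; rewrite ?inE//.
    exact: measurableC.
  move=> y /= xy; rewrite in_itv/= => /andP[y0 yx].
  by move: xy; rewrite ger0_norm// ltNge yx.
rewrite -lee_fin -Qsplit fineK ?fin_num_measure//.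
apply: (@le_trans _ _ (Q ([set y | x <= `|y|] `|` `]-oo, 0[%classic))).
  apply: le_measure; rewrite ?inE//.
  - exact: measurableC.
  - exact: measurableU.
  move=> y /=; rewrite !in_itv/= => /negP; rewrite negb_and -!ltNge => /orP[y0|xy]; [by right|left].
  by rewrite (le_trans (ltW xy))// ler_norm.
apply: le_trans (measureU2 _ _ _) _ => //.
by rewrite [X in (_ + X <= _)%E]Qneg adde0.
Qed.

(** The variables exp (- X) and exp (- |y|), with y exponential of rate 1/S, have equal moments.
    Comparing their laws at nearby thresholds bounds the tail at x by exp (- y/S) from below for y >
    x and from above for y < x. *)
Lemma exponential_tail d (T : measurableType d) (P : probability T R) (X : T -> R) (S x : R) :
  measurable_fun [set: T] X -> (forall t, 0 <= X t) -> 0 < S ->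
  (forall k : nat, \int[P]_t expR (- (k%:R * X t)) = (1 + k%:R * S)^-1) ->
  0 <= x -> P [set t | x < X t] = (expR (- (x / S)))%:E.
Proof.
move=> mX X0 S0 hX x0.
have r0 : 0 < S^-1 by rewrite invr_gt0.
have [Q [QE QV]] := exponential_law r0.
pose U t := expR (- X t).
pose V (y : measurableTypeR R) := expR (- `|y|).
have mU : measurable_fun setT U.
  by apply: measurableT_comp => //; exact: measurableT_comp.
have mV : measurable_fun setT V.
  apply: measurableT_comp => //; apply: measurableT_comp => //; exact: normr_measurable.
have U01 t : 0 <= U t <= 1 by rewrite expR_ge0/= -expR0 ler_expR oppr_le0.
have V01 t : 0 <= V t <= 1 by rewrite expR_ge0/= -expR0 ler_expR oppr_le0.
have UV k : \int[P]_t U t ^+ k = \int[Q]_t V t ^+ k.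
  rewrite QV; transitivity (1 + k%:R * S)^-1; last first.
    have kS : 1 + k%:R * S != 0 by rewrite gt_eqF// ltr_pwDl// mulr_ge0// ltW.
    by field; rewrite kS gt_eqF.
  rewrite -hX; apply: eq_Rintegral => t _.
  by rewrite /U -expRM_natl mulrN.
have mXx : measurable [set t | x < X t].
  rewrite (_ : [set t | _] = setT `&` X @^-1` `]x, +oo[); first exact: mX.
  by rewrite setTI; apply/seteqP; split=> t /=; rewrite in_itv/= andbT.
have lower y : x < y -> expR (- (y / S)) <= fine (P [set t | x < X t]).
  move=> xy; have y0 : 0 < y := le_lt_trans x0 xy.
  have [_] := exponential_prob_tail r0 y0 QE.
  rewrite mulrC => /le_trans; apply.
  have [_ mge] := measurable_abs_tail y.
  rewrite fine_le ?fin_num_measure//.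
  have ab : expR (- y) < expR (- x) by rewrite ltr_expR ltrN2.
  have := moments_tail_le mV mU V01 U01 (fun k => esym (UV k)) ab.
  congr (Q _ <= P _)%E; apply/seteqP; split=> t /=;
    by rewrite /V /U ?ler_expR ?ltr_expR ?lerN2 ?ltrN2.
have upper y : 0 < y -> y < x -> fine (P [set t | x < X t]) <= expR (- (y / S)).
  move=> y0 yx.
  have [+ _] := exponential_prob_tail r0 y0 QE.
  rewrite [_^-1 * _]mulrC; apply: le_trans.
  have [mgt _] := measurable_abs_tail y.
  rewrite fine_le ?fin_num_measure//.
  have ab : expR (- x) < expR (- y) by rewrite ltr_expR ltrN2.
  have := moments_tail_le mU mV U01 V01 UV ab.
  rewrite (_ : [set t | V t < _] = [set y' | y < `|y'|]); last first.
    by apply/seteqP; split=> t /=; rewrite /V ltr_expR ltrN2.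
  apply: le_trans; apply: le_measure; rewrite ?inE//.
    rewrite -[X in measurable X]setTI; exact: measurable_fun_le.
  by move=> t /= xt; rewrite /U ler_expR lerN2 ltW.
have p1 : fine (P [set t | x < X t]) <= 1.
  by rewrite -lee_fin fineK ?fin_num_measure// probability_le1.
rewrite -[LHS]fineK ?fin_num_measure//; congr EFin.
apply/eqP; rewrite eq_le; apply/andP; split.
  (* At x = 0 there is no positive threshold below x, but there the bound is 1. *)
  have [xpos|xneg] := ltP 0 x; last first.
    by rewrite (le_trans p1)// -expR0 ler_expR oppr_ge0 pmulr_lle0 ?invr_gt0.
  apply/ler_addgt0Pr => e e0.
  (* The term x / 2 keeps the threshold x - d0 positive, and e S makes d0 / S at most e. As exp (-
     d0/S) >= 1 - e and the probability is at most 1, the loss is at most e. *)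
  set d0 := Num.min (x / 2) (e * S).
  have d0_gt0 : 0 < d0 by rewrite lt_min divr_gt0//= mulr_gt0.
  have d0x : d0 < x.
    by rewrite (@le_lt_trans _ _ (x / 2)) ?ge_min ?lexx// ltr_pdivrMr// mulr_natr mulr2n ltrDl.
  have d0e : d0 / S <= e by rewrite ler_pdivrMr// ge_min lexx orbT.
  have : fine (P [set t | x < X t]) * expR (- (d0 / S)) <= expR (- (x / S)).
    rewrite -ler_pdivlMr ?expR_gt0// -expRN opprK -expRD.
    rewrite (le_trans (upper (x - d0) _ _)) ?subr_gt0 ?gtrBl// ler_expR.
    by rewrite mulrBl opprB addrC.
  have p0 : 0 <= fine (P [set t | x < X t]) by rewrite fine_ge0.
  have := expR_ge1Dx (- (d0 / S)).
  have dS0 : 0 <= d0 / S by rewrite divr_ge0 ?ltW.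
  nra.
apply/ler_addgt0Pr => e e0.
(* The shift e S costs a factor exp (- e) >= 1 - e, hence at most e. *)
have := lower (x + e * S).
rewrite ltrDl mulr_gt0// => /(_ isT).
rewrite mulrDl mulfK ?gt_eqF// opprD expRD.
have := expR_ge1Dx (- e).
have e1 : expR (- (x / S)) <= 1 by rewrite -expR0 ler_expR oppr_le0 divr_ge0// ltW.
have := expR_ge0 (- (x / S)).
nra.
Qed.

End exponential_tail.

Local Open Scope complex_scope.
Local Open Scope sesquilinear_scope.
Local Open Scope ring_scope.

(** * Linear functionals of complex normal vectors *)

Lemma measurable_tuple_dot (R : realType) n (u : 'cV[R]_n) :
  measurable_fun [set: n.-tuple R] (fun x => \sum_i u i 0 * tnth x i).
Proof.
apply: (@measurable_sum _ _ _ _ _ _ (fun i (x : n.-tuple R) => u i 0 * tnth x i)) => i.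
by apply: measurable_funM => //; exact: measurable_tnth.
Qed.

Lemma tuple_dotE (R : realType) n (u x : 'cV[R]_n) :
  \sum_i u i 0 * tnth (tuple_of_cV x) i = \sum_i u i 0 * x i 0.
Proof. by apply: eq_bigr => i _; rewrite tnth_mktuple. Qed.

Lemma measurable_vector_dot d (T : measurableType d) (R : realType) n
    (X : T -> 'cV[R]_n) (u : 'cV[R]_n) : random_vector X ->
  measurable_fun [set: T] (fun t => \sum_i u i 0 * X t i 0).
Proof.
move=> mX; under eq_fun do rewrite -tuple_dotE.
exact: measurableT_comp (measurable_tuple_dot u) mX.
Qed.

Lemma eq_law_dot_cos (R : realType) n
    d1 (T1 : measurableType d1) (P1 : probability T1 R) (X1 : T1 -> 'cV[R]_n)
    d2 (T2 : measurableType d2) (P2 : probability T2 R) (X2 : T2 -> 'cV[R]_n)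
    (u : 'cV[R]_n) (s c : R) :
  random_vector X1 -> random_vector X2 -> eq_law P1 X1 P2 X2 ->
  \int[P1]_t cos (s * (\sum_i u i 0 * X1 t i 0) + c) =
  \int[P2]_t cos (s * (\sum_i u i 0 * X2 t i 0) + c).
Proof.
move=> m1 m2 e.
under eq_Rintegral do rewrite -tuple_dotE.
under [RHS]eq_Rintegral do rewrite -tuple_dotE.
apply: (@eq_law_Rintegral _ _ _ _ _ _ _ P1 P2 _ _
  (fun x => cos (s * (\sum_i u i 0 * tnth x i) + c)) 1 m1 m2 e); last first.
  by move=> x; exact: cos_abs_le1.
apply: (measurableT_comp (measurable_cos_affine s c)).
exact: measurable_tuple_dot.
Qed.

Lemma eq_law_dot_sqr (R : realType) n
    d1 (T1 : measurableType d1) (P1 : probability T1 R) (X1 : T1 -> 'cV[R]_n)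
    d2 (T2 : measurableType d2) (P2 : probability T2 R) (X2 : T2 -> 'cV[R]_n)
    (u : 'cV[R]_n) :
  random_vector X1 -> random_vector X2 -> eq_law P1 X1 P2 X2 ->
  (\int[P1]_t ((\sum_i u i 0 * X1 t i 0) ^+ 2)%:E =
   \int[P2]_t ((\sum_i u i 0 * X2 t i 0) ^+ 2)%:E)%E.
Proof.
move=> m1 m2 e.
under eq_integral do rewrite -tuple_dotE.
under [RHS]eq_integral do rewrite -tuple_dotE.
apply: (@eq_law_integral _ _ _ _ _ _ _ P1 P2 _ _
  (fun x => ((\sum_i u i 0 * tnth x i) ^+ 2)%:E) m1 m2 e); last first.
  by move=> x; rewrite lee_fin sqr_ge0.
apply/measurable_EFinP; apply: measurable_funX.
exact: measurable_tuple_dot.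
Qed.

(** A linear functional of A W + b is again affine in W: [m] is u . b and [v] the squared norm of
    the transpose of A applied to u. Both stay existential, since symmetry and covariance determine
    them later. *)
Lemma gaussian_vector_cos d (T : measurableType d) (R : realType)
    (P : probability T R) n (X : T -> 'cV[R]_n) (u : 'cV[R]_n) :
  gaussian_vector P X ->
  exists m v : R, forall s c,
    \int[P]_t cos (s * (\sum_i u i 0 * X t i 0) + c) =
    cos (s * m + c) * expR (- (s ^+ 2 * v / 2)).
Proof.
move=> [mX [p [A [b [d' [T' [P' [W [hW e]]]]]]]]].
pose a j := \sum_i u i 0 * A i j.
exists (\sum_i u i 0 * b i 0), (\sum_j a j ^+ 2) => s c.
have mWj j : measurable_fun [set: T'] (fun t => W t j 0).
  by apply: random_vector_coord; case: hW.
have mAW : random_vector (fun t => A *m W t + b).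
  apply/measurable_fun_tnthP => i.
  rewrite (_ : _ \o _ = fun t => \sum_j A i j * W t j 0 + b i 0); last first.
    by apply/funext => t /=; rewrite tnth_mktuple !mxE.
  apply: measurable_funD => //.
  apply: (@measurable_sum _ _ _ _ _ _ (fun j t => A i j * W t j 0)) => j.
  exact: measurable_funM.
rewrite (eq_law_dot_cos u s c mX mAW e).
have -> : s ^+ 2 * (\sum_j a j ^+ 2) = \sum_j (s * a j) ^+ 2.
  by rewrite mulr_sumr; apply: eq_bigr => j _; rewrite exprMn.
rewrite -(standard_gaussian_cos _ hW); apply: eq_Rintegral => t _; congr cos.
rewrite addrA; congr (_ + _).
under eq_bigr do rewrite !mxE mulrDr.
rewrite big_split/= mulrDr; congr (_ + _).
rewrite mulr_sumr.
transitivity (\sum_i \sum_j s * (u i 0 * A i j * W t j 0)).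
  by apply: eq_bigr => i _; rewrite !mulr_sumr; apply: eq_bigr => j _; congr (_ * _); rewrite mulrA.
rewrite exchange_big/=; apply: eq_bigr => j _.
by rewrite /a -mulr_sumr -mulr_suml mulrA.
Qed.

(** The real inner product of the realifications, written so as to keep track of complex scalars:
    replacing [u] by i u gives the imaginary part of u^H z. *)
Definition rdot (R : realType) n (u z : 'cV[R[i]]_n) : R :=
  complex.Re ((u^t* *m z) 0 0).

Lemma complex_ReM (R : realType) (x y : R[i]) :
  complex.Re (x * y) = complex.Re x * complex.Re y - complex.Im x * complex.Im y.
Proof. by case: x => a b; case: y. Qed.

Lemma complex_Re_sum (R : realType) (I : finType) (F : I -> R[i]) :
  complex.Re (\sum_i F i) = \sum_i complex.Re (F i).
Proof. by rewrite (big_morph (@complex.Re R) (id1 := 0) (op1 := +%R))// => -[a b] [c d]. Qed.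

Lemma rdotE (R : realType) n (u z : 'cV[R[i]]_n) :
  rdot u z = \sum_i realify u i 0 * realify z i 0.
Proof.
rewrite /rdot mxE complex_Re_sum big_split_ord/= -big_split/=.
apply: eq_bigr => i _.
rewrite /realify !col_mxEu !col_mxEd !mxE complex_ReM.
by case: (u i 0) => a b /=; rewrite mulNr opprK.
Qed.

Lemma rdotZr (R : realType) n (c : R[i]) (u z : 'cV[R[i]]_n) :
  rdot u (c *: z) = rdot (conjc c *: u) z.
Proof.
rewrite /rdot -scalemxAr; congr complex.Re.
rewrite [in RHS]linearZ/= map_mxZ -scalemxAl.
by rewrite -[c in LHS]conjcK.
Qed.

Section complex_normal.
Context d (T : measurableType d) (R : realType) (P : probability T R) (n : nat).
Variables (Z : T -> 'cV[R[i]]_n) (S : 'M[R[i]]_n).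
Hypothesis hZ : complex_normal0 P Z S.

Let mZ : random_vector (fun t => realify (Z t)).
Proof. by case: hZ => -[]. Qed.

Lemma measurable_rdot (u : 'cV[R[i]]_n) : measurable_fun [set: T] (fun t => rdot u (Z t)).
Proof. by under eq_fun do rewrite rdotE; exact: measurable_vector_dot. Qed.

Let mRe i : measurable_fun [set: T] (fun t => complex.Re (Z t i 0)).
Proof.
have := random_vector_coord (lshift n i) mZ.
by under eq_fun do rewrite /realify col_mxEu mxE.
Qed.

Let mIm i : measurable_fun [set: T] (fun t => complex.Im (Z t i 0)).
Proof.
have := random_vector_coord (rshift n i) mZ.
by under eq_fun do rewrite /realify col_mxEd mxE.
Qed.

Let mrot phi : random_vector (fun t => realify ((cos phi +i* sin phi) *: Z t)).
Proof.
apply/measurable_fun_tnthP => i.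
rewrite (_ : _ \o _ = fun t => realify ((cos phi +i* sin phi) *: Z t) i 0); last first.
  by apply/funext => t /=; rewrite tnth_mktuple.
rewrite /realify; case: (split_ordP i) => j ->.
  under eq_fun do rewrite col_mxEu !mxE complex_ReM/=.
  by apply: measurable_funB; exact: measurable_funM.
under eq_fun do rewrite col_mxEd !mxE.
rewrite (_ : (fun _ => _) = fun t => cos phi * complex.Im (Z t j 0) + sin phi * complex.Re (Z t j 0)).
  by apply: measurable_funD; exact: measurable_funM.
by apply/funext => t; case: (Z t j 0).
Qed.

Let rot_cos phi u s c :
  \int[P]_t cos (s * rdot u ((cos phi +i* sin phi) *: Z t) + c) =
  \int[P]_t cos (s * rdot u (Z t) + c).
Proof.
under eq_Rintegral do rewrite rdotE.
under [RHS]eq_Rintegral do rewrite rdotE.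
by apply: eq_law_dot_cos => //; case: hZ.
Qed.

Let rot_sqr phi u :
  (\int[P]_t ((rdot u ((cos phi +i* sin phi) *: Z t)) ^+ 2)%:E =
   \int[P]_t ((rdot u (Z t)) ^+ 2)%:E)%E.
Proof.
under eq_integral do rewrite rdotE.
under [RHS]eq_integral do rewrite rdotE.
by apply: eq_law_dot_sqr => //; case: hZ.
Qed.

Let centered_cos u : exists v, forall s c,
  \int[P]_t cos (s * rdot u (Z t) + c) = cos c * expR (- (s ^+ 2 * v / 2)).
Proof.
have [gZ _ _ _] := hZ.
have [m [v h0]] := gaussian_vector_cos (realify u) gZ.
have h s c : \int[P]_t cos (s * rdot u (Z t) + c) = cos (s * m + c) * expR (- (s ^+ 2 * v / 2)).
  by rewrite -h0; apply: eq_Rintegral => t _; rewrite rdotE.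
(* Rotation by pi changes the sign of [s], and the phase pi / 2 turns the cosines into sines: sin (s
   m) equals its opposite. *)
have sm s : sin (s * m) = 0.
  have := rot_cos pi u s (pi / 2); rewrite h.
  have -> : \int[P]_t cos (s * rdot u ((cos pi +i* sin pi) *: Z t) + pi / 2) =
     \int[P]_t cos (- s * rdot u (Z t) + pi / 2).
    apply: eq_Rintegral => t _; congr (cos (_ + _)).
    rewrite mulNr -mulrN; congr (_ * _); rewrite /rdot -scalemxAr mxE.
    by rewrite complex_ReM/= cospi sinpi mul0r subr0 mulN1r.
  rewrite h sqrrN => /(mulIf (negbT (gt_eqF (expR_gt0 _)))).
  rewrite !cosDpihalf mulNr sinN => /eqP; rewrite -subr_eq0 opprK -mulr2n.
  by rewrite mulrn_eq0/= => /eqP.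
have m0 : m = 0.
  (* At s = pi / (2 m) the sine would be 1. *)
  apply/eqP; apply/negP => /negP m0; have := sm (pi / 2 / m).
  by rewrite divfK// sin_pihalf => /eqP; rewrite oner_eq0.
by exists v => s c; rewrite h m0 mulr0 add0r.
Qed.

Let rdot_sqr u v : (forall s c,
  \int[P]_t cos (s * rdot u (Z t) + c) = cos c * expR (- (s ^+ 2 * v / 2))) ->
  (\int[P]_t ((rdot u (Z t)) ^+ 2)%:E = v%:E)%E.
Proof.
move=> h; apply: second_moment; first exact: measurable_rdot.
by move=> s; have := h s 0; rewrite cos0 mul1r => <-; under eq_Rintegral do rewrite -[_ * _]addr0.
Qed.

Let rdot_sqr_integrable u : P.-integrable [set: T] (fun t => ((rdot u (Z t)) ^+ 2)%:E).
Proof.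
apply/integrableP; split.
  by apply/measurable_EFinP/measurable_funX; exact: measurable_rdot.
have [v hv] := centered_cos u.
under eq_integral do rewrite gee0_abs ?lee_fin ?sqr_ge0//.
by rewrite (rdot_sqr hv) ltry.
Qed.

Let integrableM (f g : T -> R) : measurable_fun [set: T] f -> measurable_fun [set: T] g ->
  P.-integrable [set: T] (fun t => (f t ^+ 2)%:E) ->
  P.-integrable [set: T] (fun t => (g t ^+ 2)%:E) ->
  P.-integrable [set: T] (EFin \o (fun t => f t * g t)).
Proof.
move=> mf mg f2 g2; apply: le_integrable (integrableD measurableT f2 g2) => //.
  by apply/measurable_EFinP; exact: measurable_funM.
move=> t _ /=; rewrite lee_fin normrM.
rewrite [leRHS]ger0_norm ?addr_ge0 ?sqr_ge0//.
rewrite -[f t ^+ 2]real_normK ?num_real// -[g t ^+ 2]real_normK ?num_real//.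
have := sqr_ge0 (`|f t| - `|g t|); have := sqr_ge0 (`|f t| + `|g t|).
nra.
Qed.

Let Re_rdot (z : 'cV[R[i]]_n) i : complex.Re (z i 0) = rdot (delta_mx i 0) z.
Proof. by rewrite /rdot trmx_delta map_delta_mx -rowE mxE. Qed.

Let Im_rdot (z : 'cV[R[i]]_n) i : complex.Im (z i 0) = rdot ('i *: delta_mx i 0) z.
Proof.
have -> : 'i = conjc (- 'i) :> R[i] by rewrite /= oppr0 opprK.
rewrite -rdotZr -Re_rdot mxE; case: (z i 0) => a b /=.
by rewrite oppr0 mul0r mulN1r opprK add0r.
Qed.

Let Re_sqr_integrable i : P.-integrable [set: T] (fun t => (complex.Re (Z t i 0) ^+ 2)%:E).
Proof. by under eq_fun do rewrite Re_rdot; exact: rdot_sqr_integrable. Qed.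

Let Im_sqr_integrable i : P.-integrable [set: T] (fun t => (complex.Im (Z t i 0) ^+ 2)%:E).
Proof. by under eq_fun do rewrite Im_rdot; exact: rdot_sqr_integrable. Qed.

Let covE i l t : (Z t *m (Z t)^t*) i l =
  (complex.Re (Z t i 0) * complex.Re (Z t l 0) + complex.Im (Z t i 0) * complex.Im (Z t l 0)) +i*
  (complex.Im (Z t i 0) * complex.Re (Z t l 0) - complex.Re (Z t i 0) * complex.Im (Z t l 0)).
Proof.
rewrite mxE big_ord1 !mxE; case: (Z t i 0) => a b; case: (Z t l 0) => c e.
by apply/eqP; rewrite eq_complex/= mulrN opprK mulrN eqxx/= addrC.
Qed.

Let ReM_integrable i l : P.-integrable [set: T]
  (EFin \o (fun t => complex.Re ((Z t *m (Z t)^t*) i l))).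
Proof.
rewrite /comp; under eq_fun do rewrite covE/= EFinD.
by apply: integrableD => //; apply: integrableM.
Qed.

Let ImM_integrable i l : P.-integrable [set: T]
  (EFin \o (fun t => complex.Im ((Z t *m (Z t)^t*) i l))).
Proof.
rewrite /comp; under eq_fun do rewrite covE/= EFinB.
by apply: integrableB => //; apply: integrableM.
Qed.

(** Multiplying z by i turns the real part of u^H z into minus its imaginary part, so both sides are
    |u^H z|^2. *)
Let sqr_rdot u (z : 'cV[R[i]]_n) :
  rdot u z ^+ 2 + rdot u ('i *: z) ^+ 2 = complex.Re ((u^t* *m (z *m z^t*) *m u) 0 0).
Proof.
rewrite mulmxA -mulmxA -[u in X in _ = complex.Re ((_ *m X) 0 0)]trmxCK.
rewrite -map_mxM -trmx_mul /rdot -scalemxAr; move: (u^t* *m z) => D.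
rewrite !mxE big_ord1 !mxE (_ : ord0 = 0 :> 'I_1)//; case: (D 0 0) => a b /=.
by rewrite mul0r mul1r sub0r sqrrN mulrN opprK !expr2.
Qed.

Let quadratic_mean (u : 'cV[R[i]]_n) :
  \int[P]_t complex.Re ((u^t* *m (Z t *m (Z t)^t*) *m u) 0 0) =
  complex.Re ((u^t* *m S *m u) 0 0).
Proof.
pose k i l : R[i] := (u^t* 0 i) * u l 0.
have e (M : 'M[R[i]]_n) : complex.Re ((u^t* *m M *m u) 0 0) =
    \sum_l \sum_i (complex.Re (k i l) * complex.Re (M i l) - complex.Im (k i l) * complex.Im (M i l)).
  rewrite mxE complex_Re_sum; apply: eq_bigr => l _.
  rewrite mxE mulr_suml complex_Re_sum; apply: eq_bigr => i _.
  by rewrite -complex_ReM /k mulrAC.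
rewrite e; under eq_Rintegral do rewrite e.
have i1 i l : P.-integrable [set: T]
    (EFin \o (fun t => complex.Re (k i l) * complex.Re ((Z t *m (Z t)^t*) i l))).
  by rewrite /comp; under eq_fun do rewrite EFinM; apply: integrableZl => //; exact: ReM_integrable.
have i2 i l : P.-integrable [set: T]
    (EFin \o (fun t => complex.Im (k i l) * complex.Im ((Z t *m (Z t)^t*) i l))).
  by rewrite /comp; under eq_fun do rewrite EFinM; apply: integrableZl => //; exact: ImM_integrable.
have i12 i l : P.-integrable [set: T]
    (EFin \o (fun t => complex.Re (k i l) * complex.Re ((Z t *m (Z t)^t*) i l) -
       complex.Im (k i l) * complex.Im ((Z t *m (Z t)^t*) i l))).
  by rewrite /comp; under eq_fun do rewrite EFinB; apply: integrableB; [by []|exact: i1|exact: i2].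
rewrite Rintegral_sum => [|l]; last first.
  rewrite /comp; under eq_fun do rewrite -sumEFin.
  by apply: integrable_sum => // i _; exact: i12.
apply: eq_bigr => l _; rewrite Rintegral_sum => [|i]; last exact: i12.
apply: eq_bigr => i _; rewrite RintegralB// !RintegralZl//.
have [_ _ _ /(_ i l)[]] := hZ; rewrite unlock => h1 h2.
by rewrite /Rintegral h1 h2.
Qed.

(** Rotation by pi / 2 is multiplication by i, so the real and imaginary parts of u^H Z have the
    same second moment [v]. Their sum has mean u^H S u, hence v is half of it, and the exponent -
    v/2 explains the 4. *)
Lemma complex_normal0_cos (u : 'cV[R[i]]_n) (c : R) :
  \int[P]_t cos (rdot u (Z t) + c) =
  cos c * expR (- (complex.Re ((u^t* *m S *m u) 0 0) / 4)).
Proof.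
have [v hv] := centered_cos u.
have vE : complex.Re ((u^t* *m S *m u) 0 0) = v + v.
  rewrite -quadratic_mean; under eq_Rintegral do rewrite -sqr_rdot.
  have h1 := rdot_sqr hv; have := rot_sqr (pi / 2) u.
  rewrite h1 cos_pihalf sin_pihalf => h2.
  rewrite RintegralD//; last 2 first.
  - exact: rdot_sqr_integrable.
  - rewrite /comp; under eq_fun do rewrite rdotZr; exact: rdot_sqr_integrable.
  by rewrite /Rintegral h1 h2.
have := hv 1 c; under eq_Rintegral do rewrite mul1r.
move=> ->; congr (_ * expR _); rewrite vE.
by field.
Qed.

End complex_normal.

(** * The secrecy outage probability *)

Lemma rdotZl (R : realType) n (c : R[i]) (u z : 'cV[R[i]]_n) :
  rdot (c *: u) z = complex.Re c * rdot u z + complex.Im c * rdot ('i *: u) z.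
Proof.
have e (k : R[i]) : rdot (k *: u) z = complex.Re (conjc k * (u^t* *m z) 0 0).
  by rewrite -[k in LHS]conjcK -rdotZr /rdot -scalemxAr mxE.
rewrite !e /rdot; case: ((u^t* *m z) 0 0) => x y; case: c => a b /=.
by rewrite mul0r !mulNr !opprK mul1r add0r.
Qed.

Lemma rdotC (R : realType) n (u z : 'cV[R[i]]_n) : rdot u z = rdot z u.
Proof. by rewrite !rdotE; apply: eq_bigr => i _; rewrite mulrC. Qed.

Lemma scaled_quadratic (R : realType) n (k : R[i]) (s : R) (u : 'cV[R[i]]_n) :
  complex.Re (((k *: u)^t* *m (s%:C)%:M *m (k *: u)) 0 0) =
  s * (complex.Re k ^+ 2 + complex.Im k ^+ 2) * complex.Re ((u^t* *m u) 0 0).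
Proof.
have -> : (k *: u)^t* = conjc k *: u^t* by rewrite linearZ/= map_mxZ.
rewrite mul_mx_scalar -?scalemxAl -?scalemxAr -?scalemxAl; move: (u^t* *m u) => A.
rewrite !mxE; move: (A 0 0).
case=> x y; case: k => a b /=.
by ring.
Qed.

Lemma rdot_self_ge0 (R : realType) n (u : 'cV[R[i]]_n) :
  0 <= complex.Re ((u^t* *m u) 0 0).
Proof.
rewrite -/(rdot u u) rdotE; apply: sumr_ge0 => i _.
by rewrite -expr2 sqr_ge0.
Qed.

(** Integrating over Y with the functional of X as phase leaves the cosine of that functional times
    a constant; independence thus makes the variances add. *)
Lemma independent_normal_cos d (T : measurableType d) (R : realType)
    (P : probability T R) m n (X : T -> 'cV[R[i]]_m) (Y : T -> 'cV[R[i]]_n)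
    (a b : R) (u : 'cV[R[i]]_m) (v : 'cV[R[i]]_n) :
  complex_normal0 P X (a%:C)%:M -> complex_normal0 P Y (b%:C)%:M ->
  independent_vectors P (fun t => realify (X t)) (fun t => realify (Y t)) ->
  \int[P]_t cos (rdot u (X t) + rdot v (Y t)) =
  expR (- ((a * rdot u u + b * rdot v v) / 4)).
Proof.
move=> hX hY ind.
have mX := measurable_rdot hX u; have mY := measurable_rdot hY v.
pose f (z : R * R) := cos (z.1 + z.2).
rewrite [LHS](@independent_Rintegral _ _ _ P _ _ f 1 mX mY); first last.
- by move=> z; exact: cos_abs_le1.
- apply: (@measurableT_comp _ _ _ _ _ _ cos).
    exact: continuous_measurable_fun (@continuous_cos R).
  exact: measurable_funD.
- move=> A B mA mB.
  have pre p (Z : T -> 'cV[R[i]]_p) (k : 'cV[R[i]]_p) (C : set R) :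
      (fun t => rdot k (Z t)) @^-1` C =
      [set t | [set x | C (\sum_i realify k i 0 * tnth x i)] (tuple_of_cV (realify (Z t)))].
    by apply/seteqP; split=> t /=; rewrite tuple_dotE rdotE.
  have mpre p (k : 'cV[R[i]]_p) (C : set R) : measurable C ->
      measurable [set x : (p + p).-tuple R | C (\sum_i realify k i 0 * tnth x i)].
    move=> mC; rewrite -[X in measurable X]setTI.
    exact: (measurable_tuple_dot (realify k)).
  by rewrite !pre; apply: ind; exact: mpre.
have q p (k : 'cV[R[i]]_p) (s : R) :
    complex.Re ((k^t* *m (s%:C)%:M *m k) 0 0) = s * rdot k k.
  have := scaled_quadratic 1 s k.
  by rewrite scale1r /= expr1n expr0n addr0 mulr1.
under eq_Rintegral => s _.
  under eq_Rintegral do rewrite /f/= addrC.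
  rewrite (complex_normal0_cos hY) q; over.
rewrite /= RintegralZr//; last first.
  apply: (@probability_bounded_integrable _ _ _ _ _ 1) => [|t]; last exact: cos_abs_le1.
  apply: (@measurableT_comp _ _ _ _ _ _ cos) => //.
  exact: continuous_measurable_fun (@continuous_cos R).
under eq_Rintegral do rewrite -[rdot _ _]addr0.
by rewrite (complex_normal0_cos hX) q cos0 mul1r -expRD; congr expR; field.
Qed.

Lemma lt_log2E (R : realType) (D y : R) : 0 < y -> (D < log2 y) = (2 `^ D < y).
Proof.
move=> y0; have l2 : 0 < ln (2 : R) by rewrite ln_gt0// ltr1n.
by rewrite /log2 ltr_pdivlMr// -[in RHS](lnK y0) /powR pnatr_eq0/= ltr_expR.
Qed.

(** The condition on [denom] excludes a signal that vanishes almost surely: division by 0 gives 0,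
    so the right side would be 1, whereas the outage event has probability 0 when D >= 0. *)
Theorem theorem1 (R : realType) (d : measure_display) (T : measurableType d)
  (P : probability T R) (N M K J : nat)
  (H : 'M[R[i]]_(M, N)) (Theta : 'M[R[i]]_M) (w : 'cV[R[i]]_N)
  (g_r : 'I_J -> T -> 'cV[R[i]]_M) (g_d : 'I_J -> T -> 'cV[R[i]]_N)
  (D : 'I_K -> 'I_J -> R)
  (alpha1 : R) (alpha_r alpha_d mu_r mu_d sigma : 'I_J -> R)
  (Theta_diag : is_diag_mx Theta)
  (Theta_unit : forall m : 'I_M, `|Theta m m| = 1)
  (D_ge0 : forall k j, 0 <= D k j)
  (alpha1_ge0 : 0 <= alpha1)
  (alpha_r_ge0 : forall j, 0 <= alpha_r j)
  (alpha_d_ge0 : forall j, 0 <= alpha_d j)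
  (sigma2_gt0 : forall j, 0 < sigma j ^+ 2)
  (g_r_law : forall j, complex_normal0 P (g_r j) ((mu_r j ^+ 2)%:C)%:M)
  (g_d_law : forall j, complex_normal0 P (g_d j) ((mu_d j ^+ 2)%:C)%:M)
  (g_indep : forall j, independent_vectors P
     (fun t => realify (g_r j t)) (fun t => realify (g_d j t))) :
  let kappa1 j := alpha1 * alpha_r j * mu_r j ^+ 2 / sigma j ^+ 2 in
  let kappa2 j := alpha_d j * mu_d j ^+ 2 / sigma j ^+ 2 in
  let denom j :=
    kappa1 j * complex.Re (((Theta *m H *m w)^t* *m (Theta *m H *m w)) 0 0)
    + kappa2 j * complex.Re ((w^t* *m w) 0 0) in
  forall (k : 'I_K) (j : 'I_J), denom j != 0 ->
  P [set t | D k j < log2 (1 + Normc.normc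
       ((((Num.sqrt (alpha1 * alpha_r j))%:C *: ((g_r j t)^t* *m Theta *m H)
          + (Num.sqrt (alpha_d j))%:C *: (g_d j t)^t*) *m w) 0 0) ^+ 2
       / sigma j ^+ 2)]
  = (expR (- ((2 `^ D k j - 1) / denom j)))%:E.

Proof.
move=> kappa1 kappa2 denom k j denom0.
set u := Theta *m H *m w.
set c1 := Num.sqrt (alpha1 * alpha_r j); set c2 := Num.sqrt (alpha_d j).
have s0 := sigma2_gt0 j.
(* The mean of the squared modulus of the received scalar. *)
pose S := c1 ^+ 2 * mu_r j ^+ 2 * rdot u u + c2 ^+ 2 * mu_d j ^+ 2 * rdot w w.
have c1E : c1 ^+ 2 = alpha1 * alpha_r j by rewrite sqr_sqrtr// mulr_ge0.
have c2E : c2 ^+ 2 = alpha_d j by rewrite sqr_sqrtr.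
have SE : S = denom j * sigma j ^+ 2.
  rewrite /S /denom /kappa1 /kappa2 c1E c2E /rdot -/u.
  by field; rewrite -sqrf_eq0 gt_eqF.
have S0 : 0 < S.
  rewrite lt_neqAle eq_sym; apply/andP; split; first by rewrite SE mulf_neq0// gt_eqF.
  by rewrite addr_ge0// mulr_ge0 ?rdot_self_ge0// mulr_ge0// sqr_ge0.
pose X t := c1 * rdot u (g_r j t) + c2 * rdot w (g_d j t).
pose Y t := c1 * rdot ('i *: u) (g_r j t) + c2 * rdot ('i *: w) (g_d j t).
have mX : measurable_fun setT X.
  by apply: measurable_funD; apply: measurable_funM => //;
    exact: (measurable_rdot (g_r_law j)) || exact: (measurable_rdot (g_d_law j)).
have mY : measurable_fun setT Y.
  by apply: measurable_funD; apply: measurable_funM => //;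
    exact: (measurable_rdot (g_r_law j)) || exact: (measurable_rdot (g_d_law j)).
have XY_cos a b : \int[P]_t cos (a * X t + b * Y t) = expR (- ((a ^+ 2 + b ^+ 2) * S / 4)).
  (* By [rdotZl], a X + b Y is the functional obtained by scaling [u] and [w] by c1 (a + i b) and c2
     (a + i b); the squared moduli of these scalars produce a^2 + b^2. *)
  pose ka : R[i] := (c1 * a) +i* (c1 * b); pose kb : R[i] := (c2 * a) +i* (c2 * b).
  transitivity (\int[P]_t cos (rdot (ka *: u) (g_r j t) + rdot (kb *: w) (g_d j t))).
    apply: eq_Rintegral => t _; rewrite !(rdotZl ka) !(rdotZl kb) /X /Y /=.
    by congr cos; ring.
  rewrite (independent_normal_cos _ _ (g_r_law j) (g_d_law j) (g_indep j)).
  have q p (z : 'cV[R[i]]_p) (kk : R[i]) :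
      rdot (kk *: z) (kk *: z) = (complex.Re kk ^+ 2 + complex.Im kk ^+ 2) * rdot z z.
    by have := scaled_quadratic kk 1 z; rewrite mul_mx_scalar scale1r mul1r.
  by rewrite !q /= /S; congr expR; field.
have XY0 t : 0 <= X t ^+ 2 + Y t ^+ 2 by rewrite addr_ge0// sqr_ge0.
have normE t : Normc.normc
    (((c1%:C *: ((g_r j t)^t* *m Theta *m H) + c2%:C *: (g_d j t)^t*) *m w) 0 0) ^+ 2 =
    X t ^+ 2 + Y t ^+ 2.
  rewrite /X /Y !(rdotC _ (g_r j t)) !(rdotC _ (g_d j t)) /rdot -!scalemxAr.
  rewrite mulmxDl -!scalemxAl -(mulmxA _ Theta) -(mulmxA _ (Theta *m H)) -/u.
  move: ((g_r j t)^t* *m u) ((g_d j t)^t* *m w) => A B.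
  rewrite !mxE; case: (A 0 0) => x1 y1; case: (B 0 0) => x2 y2 /=.
  rewrite sqr_sqrtr ?addr_ge0 ?sqr_ge0//.
  by ring.
(* Nonnegative redundancy rates make the threshold nonnegative, as the exponential tail requires. *)
have D1 : 0 <= 2 `^ D k j - 1.
  by rewrite subr_ge0 -[leLHS](powRr0 2) ler_powR// ler1n.
rewrite (_ : [set t | _] = [set t | (2 `^ D k j - 1) * sigma j ^+ 2 < X t ^+ 2 + Y t ^+ 2]).
  rewrite (@exponential_tail _ _ _ P (fun t => X t ^+ 2 + Y t ^+ 2) S)//.
  - by rewrite SE -mulf_div divff ?mulr1// gt_eqF.
  - by apply: measurable_funD; exact: measurable_funX.
  - by move=> l; apply: laplace_sum_sqr => //; exact: ltW.
  - by rewrite mulr_ge0// ltW.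
have ev t : (D k j < log2 (1 + (X t ^+ 2 + Y t ^+ 2) / sigma j ^+ 2)) =
    ((2 `^ D k j - 1) * sigma j ^+ 2 < X t ^+ 2 + Y t ^+ 2).
  rewrite lt_log2E; last by rewrite ltr_pwDl// divr_ge0// ltW.
  by rewrite -ltr_pdivlMr// ltrBlDl.
by apply/seteqP; split=> t /=; rewrite normE ev.
Qed.
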